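(* Let $E$ be a Köthe function space over the complete $\sigma$-finite measure space $(S,\mathcal{A},\mu)$ and let $X$ be a $\mathrm{sluacs}^+$ Banach space. If $E^*$ has the Kadets-Klee* property and in addition (a) $E$ is $\mathrm{sluacs}^+$, reflexive and has the Kadets-Klee property, or (b) $E$ is LUR and $B_{E^*}$ is weak*-sequentially compact, then $E(X)$ is $\mathrm{sluacs}^+$.
   Context: All Banach spaces are real. For a Banach space $X$, $X^*$ denotes its dual, $B_X$ its closed unit ball and $S_X$ its unit sphere. A Banach space $X$ is called: - LUR (locally uniformly rotund) if for every $x\in S_X$ and every sequence $(x_n)$ in $S_X$, $\|x_n+x\|\to2$ implies $\|x_n-x\|\to0$; - $\mathrm{sluacs}^+$ if for every $x\in S_X$, every sequence $(x_n)$ in $S_X$ with $\|x_n+x\|\to2$ and all sequences $(x_n^* )$ in $S_{X^*}$: $x_n^*(x_n)\to1$ if and only if $x_n^*(x)\to1$. A Banach space $X$ has the Kadets-Klee property if for every sequence $(x_n)$ in $X$ and each $x\in X$: $x_n\to x$ weakly and $\|x_n\|\to\|x\|$ imply $\|x_n-x\|\to0$. A dual space $X^*$ has the Kadets-Klee* property if it satisfies the same condition (for sequences in $X^*$) with weak convergence replaced by weak*-convergence. A Köthe function space over a complete, $\sigma$-finite measure space $(S,\mathcal{A},\mu)$ is a Banach space $(E,\|\cdot\|_E)$ of real-valued measurable functions on $S$ modulo equality $\mu$-a.e. such that: (i) $\chi_A\in E$ for every $A\in\mathcal{A}$ with $\mu(A)<\infty$; (ii) every $f\in E$ is $\mu$-integrable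 over every $A\in\mathcal{A}$ with $\mu(A)<\infty$; (iii) if $g$ is measurable and $f\in E$ with $|g(t)|\le|f(t)|$ $\mu$-a.e., then $g\in E$ and $\|g\|_E\le\|f\|_E$. For a Köthe function space $E$ and a Banach space $X$, the Köthe-Bochner space $E(X)$ is the Banach space of all Bochner-measurable functions $f:S\to X$ (modulo equality a.e.) with $\|f(\cdot)\|\in E$, normed by $\|f\|_{E(X)}=\|\,\|f(\cdot)\|\,\|_E$; Bochner-measurable means being the $\mu$-a.e. norm limit of a sequence of simple functions. *)

(* Defs.v *)
From HB Require Import structures.
From mathcomp Require Import all_boot all_order all_algebra.
From mathcomp Require Import all_classical all_reals all_analysis.
From mathcomp Require Import measurable_realfun.

Set Implicit Arguments.
Unset Strict Implicit.
Unset Printing Implicit Defensive.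
Import Order.TTheory GRing.Theory Num.Theory.
Import numFieldNormedType.Exports.
Local Open Scope classical_set_scope.
Local Open Scope ring_scope.

Section dual.
Context {R : realType} (X : normedModType R).

Definition dual_pred : {pred X -> R} := fun f =>
  `[< (forall a x y, f (a *: x + y) = a * f x + f y) /\ continuous f >].

Record dual := Dual { dual_fun :> X -> R ; _ : dual_fun \in dual_pred }.

HB.instance Definition _ := [isSub for dual_fun].
HB.instance Definition _ := [Choice of dual by <:].

Lemma dual_pred_submod_closed : submod_closed dual_pred.
Proof.
split.
  by apply/asboolP; split => [a x y|];
    [rewrite mulr0 addr0|exact: cst_continuous].
move=> c f g /asboolP[lf cf] /asboolP[lg cg]; apply/asboolP; split.
  move=> a x y.
  have E z : (c *: f + g) z = c * f z + g z by [].
  rewrite !E lf lg !mulrDr -!addrA.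
  by congr (_ + _); [rewrite mulrCA|rewrite addrCA].
by move=> x; apply: cvgD; [apply: cvgZl_tmp; exact: cf|exact: cg].
Qed.

HB.instance Definition _ :=
  GRing.isSubmodClosed.Build R _ dual_pred dual_pred_submod_closed.
HB.instance Definition _ := [SubChoice_isSubLmodule of dual by <:].

Definition dual_norm (f : dual) : R :=
  sup [set `|f x| | x in [set x : X | `|x| <= 1]].

Lemma dual_linear (f : dual) a x y : f (a *: x + y) = a * f x + f y.
Proof. by case: f => f /= /asboolP[]. Qed.

Lemma dual_continuous (f : dual) : continuous f.
Proof. by case: f => f /= /asboolP[]. Qed.

Lemma dual0 (f : dual) : f 0 = 0.
Proof.
by have := dual_linear f (-1) 0 0; rewrite scaler0 addr0 mulN1r addNr.
Qed.

Lemma dualZ (f : dual) a x : f (a *: x) = a * f x.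
Proof. by have := dual_linear f a x 0; rewrite !addr0 dual0 addr0. Qed.

Lemma dual_bounded (f : dual) :
  has_ubound [set `|f x| | x in [set x : X | `|x| <= 1]].
Proof.
have : f x @[x --> (0 : X)] --> (0 : R).
  by have := @dual_continuous f 0; rewrite /continuous_at dual0.
move/cvgr0Pnorm_lt/(_ 1 ltr01)/nbhs_norm0P => [e /= e0 ef].
exists (2 / e) => _ [x /= x1 <-].
have : `|f ((e / 2) *: x)| < 1.
  apply: ef => /=; rewrite normrZ gtr0_norm ?divr_gt0//.
  rewrite (@le_lt_trans _ _ (e / 2))//.
    by rewrite ler_piMr// divr_ge0// ltW.
  by rewrite ltr_pdivrMr// ltr_pMr// ltr1n.
rewrite dualZ normrM gtr0_norm ?divr_gt0// -ltr_pdivlMl ?divr_gt0// mulr1.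
by rewrite invf_div => /ltW.
Qed.

Lemma dual_sup_ge (f : dual) x : `|x| <= 1 -> `|f x| <= dual_norm f.
Proof. by move=> x1; apply: ub_le_sup; [exact: dual_bounded|exists x]. Qed.

Lemma dual_norm_le (f : dual) r :
  (forall x, `|x| <= 1 -> `|f x| <= r) -> dual_norm f <= r.
Proof.
move=> fr; apply: ge_sup; first by exists `|f 0|, 0 => //=; rewrite normr0.
by move=> _ [x /= x1 <-]; exact: fr.
Qed.

Lemma dual_norm_ge0 (f : dual) : 0 <= dual_norm f.
Proof. by apply: le_trans (@dual_sup_ge f 0 _); rewrite ?normr0. Qed.

Lemma dual_normD f g : dual_norm (f + g) <= dual_norm f + dual_norm g.
Proof.
apply: dual_norm_le => x x1.
have -> : (f + g) x = f x + g x by [].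
by rewrite (le_trans (ler_normD _ _))// lerD// dual_sup_ge.
Qed.

Lemma dual_normZ (l : R) f : dual_norm (l *: f) = `|l| * dual_norm f.
Proof.
have le_ (a : R) h : dual_norm (a *: h) <= `|a| * dual_norm h.
  apply: dual_norm_le => x x1.
  have -> : (a *: h) x = a * h x by [].
  by rewrite normrM ler_wpM2l// dual_sup_ge.
apply/eqP; rewrite eq_le le_ /=.
have [->|l0] := eqVneq l 0; first by rewrite normr0 mul0r dual_norm_ge0.
rewrite -ler_pdivlMl ?normr_gt0// -normfV.
by rewrite -{1}[f](scalerK l0) le_.
Qed.

Lemma dual_norm0_eq0 f : dual_norm f = 0 -> f = 0.
Proof.
move=> f0; apply/val_inj/funext => x; change (f x = 0).
have [->|x0] := eqVneq x 0; first exact: dual0.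
have /(@dual_sup_ge f) : `| `|x|^-1 *: x | <= 1.
  by rewrite normrZ normfV normr_id mulVf ?normr_eq0.
rewrite f0 normr_le0 dualZ mulf_eq0 invr_eq0 normr_eq0 (negPf x0)/=.
by move/eqP.
Qed.

HB.instance Definition _ :=
  Lmodule_isNormed.Build R dual dual_normD dual_normZ dual_norm0_eq0.

End dual.

Section geometry.
Context {R : realType}.

Definition LUR (X : normedModType R) : Prop :=
  forall (x : X) (x_ : nat -> X), `|x| = 1 -> (forall n, `|x_ n| = 1) ->
  `|x_ n + x| @[n --> \oo] --> (2 : R) ->
  `|x_ n - x| @[n --> \oo] --> (0 : R).

Definition sluacs_plus (X : normedModType R) : Prop :=
  forall (x : X) (x_ : nat -> X) (f_ : nat -> dual X),
  `|x| = 1 -> (forall n, `|x_ n| = 1) ->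
  `|x_ n + x| @[n --> \oo] --> (2 : R) ->
  (forall n, `|f_ n| = 1) ->
  (f_ n (x_ n) @[n --> \oo] --> (1 : R) <->
   f_ n x @[n --> \oo] --> (1 : R)).

Definition weakly_cvg (X : normedModType R) (x_ : nat -> X) (x : X) : Prop :=
  forall f : dual X, f (x_ n) @[n --> \oo] --> f x.

Definition weak_star_cvg (X : normedModType R) (f_ : nat -> dual X)
    (f : dual X) : Prop :=
  forall x : X, f_ n x @[n --> \oo] --> f x.

Definition kadets_klee (X : normedModType R) : Prop :=
  forall (x_ : nat -> X) (x : X), weakly_cvg x_ x ->
  `|x_ n| @[n --> \oo] --> `|x| -> `|x_ n - x| @[n --> \oo] --> (0 : R).

(* This is a property of the dual space of X (the weak* topology depends on
   the predual), not of X itself. *)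
Definition dual_kadets_klee_star (X : normedModType R) : Prop :=
  forall (f_ : nat -> dual X) (f : dual X), weak_star_cvg f_ f ->
  `|f_ n| @[n --> \oo] --> `|f| -> `|f_ n - f| @[n --> \oo] --> (0 : R).

Definition reflexive_space (X : normedModType R) : Prop :=
  forall phi : dual (dual X), exists x : X, forall f : dual X, phi f = f x.

Definition weak_star_seq_compact (X : normedModType R)
    (A : set (dual X)) : Prop :=
  forall f_ : nat -> dual X, (forall n, A (f_ n)) ->
  exists (k : nat -> nat) (f : dual X),
    [/\ {homo k : m n / (m < n)%N}, A f & weak_star_cvg (f_ \o k) f].

Definition closed_unit_ball (X : normedModType R) : set X :=
  [set x | `|x| <= 1].

End geometry.

Arguments closed_unit_ball {R} X _.

(* A Banach space of classes of measurable functions modulo equality a.e. is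
   encoded as an abstract Banach space together with a choice of a measurable
   function [kothe_rep u] in each class u; that classes are added, scaled and
   identified modulo equality a.e. is [kothe_linear] and [kothe_inj]. *)
Record kothe_space d (T : measurableType d) (R : realType)
    (mu : {measure set T -> \bar R}) := KotheSpace {
  kothe_sort :> completeNormedModType R ;
  kothe_rep : kothe_sort -> T -> R ;
  kothe_measurable : forall u, measurable_fun setT (kothe_rep u) ;
  kothe_inj : forall u v, kothe_rep u = kothe_rep v %[ae mu] -> u = v ;
  kothe_linear : forall (a : R) u v,
    kothe_rep (a *: u + v) = (fun t => a * kothe_rep u t + kothe_rep v t)
      %[ae mu] ;
  kothe_indic : forall A : set T, measurable A -> (mu A < +oo)%E ->
    exists u, kothe_rep u = \1_A %[ae mu] ;
  kothe_integrable : forall u (A : set T), measurable A -> (mu A < +oo)%E ->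
    mu.-integrable A (EFin \o kothe_rep u) ;
  kothe_ideal : forall (g : T -> R) u, measurable_fun setT g ->
    (\forall t \ae mu, `|g t| <= `|kothe_rep u t|) ->
    exists2 v, kothe_rep v = g %[ae mu] & `|v| <= `|u| }.

Section bochner_measurable.
Context d (T : measurableType d) (R : realType).
Context (mu : {measure set T -> \bar R}) (X : normedModType R).

(* The support need not have finite measure: when mu is sigma-finite this does
   not change the notion of Bochner-measurability. *)
Definition simple_fun (s : T -> X) : Prop :=
  finite_set (range s) /\ forall x, measurable (s @^-1` [set x]).

Definition bochner_measurable (f : T -> X) : Prop :=
  exists s : nat -> T -> X, (forall n, simple_fun (s n)) /\
    \forall t \ae mu, s n t @[n --> \oo] --> f t.

Lemma simple_fun_preimage s (B : set X) : simple_fun s ->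
  measurable (s @^-1` B).
Proof.
move=> [fs ms].
have -> : s @^-1` B = \bigcup_(x in range s `&` B) (s @^-1` [set x]).
  apply/seteqP; split => [t /= Bt|t [x [_ Bx] /= ->]//].
  by exists (s t) => //; split => //; exists t.
by apply: fin_bigcup_measurable => //; apply: sub_finite_set fs => ? [].
Qed.

Lemma simple_funS s (a : R) r :
  simple_fun s -> simple_fun r -> simple_fun (fun t => a *: s t + r t).
Proof.
move=> ss sr; have [fs ms] := ss; have [fr mr] := sr; split.
  have : finite_set
      ((fun p : X * X => a *: p.1 + p.2) @` (range s `*` range r)).
    by apply: finite_image; exact: finite_setX.
  apply: sub_finite_set => _ [t _ <-]; exists (s t, r t) => //=.
  by split; exists t.
move=> x.
have -> : (fun t => a *: s t + r t) @^-1` [set x] =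
    \bigcup_(y in range s) (s @^-1` [set y] `&` r @^-1` [set x - a *: y]).
  apply/seteqP; split => t /=.
    move=> <-; exists (s t); first by exists t.
    by split => //=; rewrite addrC addKr.
  by move=> [_ [t' _ <-]] [/= -> ->]; rewrite addrC subrK.
by apply: fin_bigcup_measurable => // y _; apply: measurableI.
Qed.

Lemma bochner_measurableS f (a : R) g : bochner_measurable f ->
  bochner_measurable g -> bochner_measurable (fun t => a *: f t + g t).
Proof.
move=> [s [ss sf]] [r [sr rg]].
exists (fun n t => a *: s n t + r n t); split => [n|]; first exact: simple_funS.
apply: filterS2 sf rg => t st rt.
by apply: cvgD => //; apply: cvgZl_tmp.
Qed.

Lemma bochner_measurable_norm f : bochner_measurable f ->
  exists2 h : T -> R, measurable_fun setT h &
    h = (fun t => `|f t|) %[ae mu].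
Proof.
move=> [s [ss [N [mN N0 sN]]]].
pose h t := if t \in N then 0 else `|f t|.
exists h; last first.
  exists N; split => // t /= nt; apply: contrapT => Nt; apply: nt => _.
  by rewrite /h memNset.
apply: (@measurable_fun_cvg _ _ _ _
    (fun n t => if t \in N then 0 else `|s n t|)) => [n|t _].
  apply: measurable_fun_ifT => //.
    by apply: (measurable_fun_bool true); rewrite setTI preimage_mem_true.
  move=> _ B mB; rewrite setTI.
  rewrite (_ : _ @^-1` B = s n @^-1` [set x | B `|x|])//.
  exact: simple_fun_preimage.
rewrite /h; case: ifPn => [tN|tN]; first exact: cvg_cst.
apply: cvg_norm; apply: contrapT => ntf; move: tN.
by rewrite notin_setE; apply; exact: sN.
Qed.

End bochner_measurable.

Section kothe_bochner.
Context d (T : measurableType d) (R : realType).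
Context (mu : {measure set T -> \bar R}) (E : kothe_space mu).
Context (X : normedModType R).

Definition kb_pred : {pred T -> X} := fun f =>
  `[< bochner_measurable mu f /\
      exists u : E, kothe_rep u = (fun t => `|f t|) %[ae mu] >].

Record kb_fun := KbFun { kb_val :> T -> X ; _ : kb_val \in kb_pred }.

HB.instance Definition _ := [isSub for kb_val].
HB.instance Definition _ := [Choice of kb_fun by <:].

Lemma kothe_rep0 : kothe_rep (0 : E) = cst 0 %[ae mu].
Proof.
have := kothe_linear 1 (0 : E) 0; rewrite scaler0 addr0.
apply: filterS => t + _ => /(_ I); rewrite mul1r => /eqP.
by rewrite eq_sym addrC -subr_eq0 addrK => /eqP.
Qed.

Lemma kothe_repZ (a : R) (u : E) :
  kothe_rep (a *: u) = (fun t => a * kothe_rep u t) %[ae mu].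
Proof.
have := kothe_linear a u 0; rewrite addr0.
by apply: filterS2 kothe_rep0 => t + + _ => /(_ I) -> /(_ I) ->; rewrite addr0.
Qed.

Lemma kothe_repD (u v : E) :
  kothe_rep (u + v) = (fun t => kothe_rep u t + kothe_rep v t) %[ae mu].
Proof.
have := kothe_linear 1 u v; rewrite scale1r.
by apply: filterS => t + _ => /(_ I) ->; rewrite mul1r.
Qed.

Lemma kb_bound (f g : T -> X) (a : R) (u v : E) :
  bochner_measurable mu f -> bochner_measurable mu g ->
  kothe_rep u = (fun t => `|f t|) %[ae mu] ->
  kothe_rep v = (fun t => `|g t|) %[ae mu] ->
  exists2 w : E, kothe_rep w = (fun t => `|a *: f t + g t|) %[ae mu] &
    `|w| <= `|a| * `|u| + `|v|.
Proof.
move=> mf mg uf vg.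
have [h mh hE] := bochner_measurable_norm (bochner_measurableS a mf mg).
have [|w wh wn] := @kothe_ideal _ _ _ _ E h (`|a| *: u + v) mh.
  have L := kothe_linear `|a| u v.
  near=> t.
  have -> : h t = `|a *: f t + g t| by near: t; apply: filterS hE => t; apply.
  have -> : kothe_rep (`|a| *: u + v) t = `|a| * kothe_rep u t + kothe_rep v t.
    by near: t; apply: filterS L => t; apply.
  have -> : kothe_rep u t = `|f t| by near: t; apply: filterS uf => t; apply.
  have -> : kothe_rep v t = `|g t| by near: t; apply: filterS vg => t; apply.
  by rewrite normr_id -normrZ (le_trans (ler_normD _ _))// ler_norm.
exists w; last first.
  by rewrite (le_trans wn)// (le_trans (ler_normD _ _))// normrZ normr_id.
by apply: filterS2 wh hE => t + + _ => /(_ I) -> /(_ I) ->.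
Unshelve. all: by end_near. Qed.

Lemma kb_pred_submod_closed : submod_closed kb_pred.
Proof.
split.
  apply/asboolP; split.
    exists (fun _ _ => 0); split; last by apply: aeW => t; exact: cvg_cst.
    move=> _; split.
      by apply: (@sub_finite_set _ _ [set 0]) => // _ [t _ <-].
    move=> x; have [->|x0] := eqVneq x 0.
      by rewrite (_ : _ @^-1` _ = setT)//; apply/seteqP; split.
    rewrite (_ : _ @^-1` _ = set0)//; apply/seteqP; split => //= t /esym/eqP.
    by rewrite (negPf x0).
  exists 0; apply: filterS kothe_rep0 => t + _ => /(_ I) ->.
  by rewrite normr0.
move=> a f g /asboolP[mf [u uf]] /asboolP[mg [v vg]]; apply/asboolP; split.
  exact: bochner_measurableS.
by have [w ? _] := kb_bound a mf mg uf vg; exists w.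
Qed.

HB.instance Definition _ :=
  GRing.isSubmodClosed.Build R _ kb_pred kb_pred_submod_closed.
HB.instance Definition _ := [SubChoice_isSubLmodule of kb_fun by <:].

Definition kb_null : {pred kb_fun} := fun f =>
  `[< (f : T -> X) = cst 0 %[ae mu] >].

Lemma kb_null_zmod_closed : zmod_closed kb_null.
Proof.
split; first by apply/asboolP; apply: aeW.
move=> f g /asboolP f0 /asboolP g0; apply/asboolP.
apply: filterS2 f0 g0 => t + + _ => /(_ I) ft /(_ I) gt.
have -> : (f - g : kb_fun) t = f t - g t by [].
by rewrite ft gt subrr.
Qed.

HB.instance Definition _ :=
  GRing.isZmodClosed.Build _ kb_null kb_null_zmod_closed.

(* E(X) itself: the functions [kb_fun] modulo equality a.e. *)
Definition kothe_bochner : Type := Quotient.quot kb_null.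
HB.instance Definition _ := Choice.on kothe_bochner.
HB.instance Definition _ := EqQuotient.on kothe_bochner.
HB.instance Definition _ := GRing.Zmodule.on kothe_bochner.

Local Open Scope quotient_scope.

Lemma kb_eqP (f g : kb_fun) :
  f = g %[mod kothe_bochner] <-> (f : T -> X) = g %[ae mu].
Proof.
have -> : (f = g %[mod kothe_bochner]) <-> f - g \in kb_null.
  by rewrite Quotient.idealrBE; split => [/eqP|/eqP].
split=> [/asboolP fg|fg]; last apply/asboolP; apply: filterS fg => t E1 _.
- by have /eqP := E1 I; rewrite subr_eq0 => /eqP.
- by apply/eqP; rewrite subr_eq0; apply/eqP/(E1 I).
Qed.

Lemma kb_reprP (f : kb_fun) :
  (repr (\pi_kothe_bochner f) : T -> X) = f %[ae mu].
Proof. by apply/kb_eqP; rewrite reprK. Qed.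

Definition kb_scale (a : R) (F : kothe_bochner) : kothe_bochner :=
  \pi_kothe_bochner (a *: repr F).

Lemma pi_kb_scale (a : R) (f : kb_fun) :
  kb_scale a (\pi_kothe_bochner f) = \pi_kothe_bochner (a *: f).
Proof.
apply/kb_eqP; apply: filterS (kb_reprP f) => t + _ => /(_ I) E1.
by change (a *: (repr (\pi_kothe_bochner f) t) = a *: f t); rewrite E1.
Qed.

Lemma pi_kbD (f g : kb_fun) : \pi_kothe_bochner (f + g) =
  (\pi_kothe_bochner f : kothe_bochner) + \pi_kothe_bochner g.
Proof. exact (@Quotient.pi_add _ kb_null f g). Qed.

Lemma pi_kb0 : \pi_kothe_bochner (0 : kb_fun) = 0.
Proof. by rewrite [RHS]/GRing.zero /= /Quotient.zero; unlock. Qed.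

Lemma kb_scalerA (a b : R) F : kb_scale a (kb_scale b F) = kb_scale (a * b) F.
Proof.
elim/quotW: F => f.
by rewrite (pi_kb_scale b) (pi_kb_scale a) (pi_kb_scale (a * b)) scalerA.
Qed.

Lemma kb_scale1r : left_id 1 kb_scale.
Proof. by elim/quotW => f; rewrite pi_kb_scale scale1r. Qed.

Lemma kb_scalerDr : right_distributive kb_scale +%R.
Proof.
move=> a; elim/quotW => f; elim/quotW => g.
by rewrite -pi_kbD (pi_kb_scale a (f + g)) scalerDr pi_kbD -!pi_kb_scale.
Qed.

Lemma kb_scalerDl F : {morph kb_scale^~ F : a b / a + b}.
Proof.
elim/quotW: F => f a b /=.
by rewrite (pi_kb_scale (a + b) f) scalerDl pi_kbD -!pi_kb_scale.
Qed.

HB.instance Definition _ := GRing.Zmodule_isLmodule.Build R kothe_bochner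
  kb_scalerA kb_scale1r kb_scalerDr kb_scalerDl.

Lemma kb_normfun_ex (f : kb_fun) :
  exists u : E, kothe_rep u = (fun t => `|f t|) %[ae mu].
Proof. by case: f => f /= /asboolP[]. Qed.

Definition kb_normfun (f : kb_fun) : E := projT1 (cid (kb_normfun_ex f)).

Lemma kb_normfunP (f : kb_fun) :
  kothe_rep (kb_normfun f) = (fun t => `|f t|) %[ae mu].
Proof. exact: projT2 (cid (kb_normfun_ex f)). Qed.

Lemma kb_normfunE (f : kb_fun) (u : E) :
  kothe_rep u = (fun t => `|f t|) %[ae mu] -> kb_normfun f = u.
Proof.
move=> uf; apply: kothe_inj.
by apply: filterS2 uf (kb_normfunP f) => t + + _ => /(_ I) -> /(_ I).
Qed.

Definition kb_norm (F : kothe_bochner) : R := `|kb_normfun (repr F)|.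

Lemma pi_kb_norm (f : kb_fun) :
  kb_norm (\pi_kothe_bochner f) = `|kb_normfun f|.
Proof.
congr `|_|; apply: kb_normfunE.
apply: filterS2 (kb_normfunP f) (kb_reprP f) => t + + _.
by move=> /(_ I) -> /(_ I) ->.
Qed.

Lemma kb_bochner_measurable (f : kb_fun) : bochner_measurable mu f.
Proof. by case: f => f /= /asboolP[]. Qed.

Lemma kb_normD F G : kb_norm (F + G) <= kb_norm F + kb_norm G.
Proof.
elim/quotW: F => f; elim/quotW: G => g; rewrite -pi_kbD !pi_kb_norm.
have [w wE wn] := kb_bound 1 (kb_bochner_measurable f)
  (kb_bochner_measurable g) (kb_normfunP f) (kb_normfunP g).
rewrite (@kb_normfunE (f + g) w); first by rewrite normr1 mul1r in wn.
by apply: filterS wE => t + _ => /(_ I) ->; rewrite scale1r.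
Qed.

Lemma kb_normZ (a : R) F : kb_norm (a *: F) = `|a| * kb_norm F.
Proof.
elim/quotW: F => f.
have -> : a *: (\pi_kothe_bochner f : kothe_bochner) =
    \pi_kothe_bochner (a *: f).
  exact: pi_kb_scale.
rewrite !pi_kb_norm -[in RHS](normr_id a) -normrZ.
congr `|_|; apply: kb_normfunE.
apply: filterS2 (kothe_repZ `|a| (kb_normfun f)) (kb_normfunP f) => t + + _.
by move=> /(_ I) -> /(_ I) ->; rewrite -normrZ.
Qed.

Lemma kb_norm0_eq0 F : kb_norm F = 0 -> F = 0.
Proof.
elim/quotW: F => f; rewrite pi_kb_norm -pi_kb0.
move/eqP; rewrite normr_eq0 => /eqP f0.
apply/kb_eqP; have := kb_normfunP f; rewrite f0.
apply: filterS2 kothe_rep0 => t + + _ => /(_ I) -> /(_ I) /esym/eqP.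
by rewrite normr_eq0 => /eqP.
Qed.

HB.instance Definition _ :=
  Lmodule_isNormed.Build R kothe_bochner kb_normD kb_normZ kb_norm0_eq0.

End kothe_bochner.

(* Main.v *)
Require Import Defs.
From mathcomp Require Import all_boot all_order all_algebra.
From mathcomp Require Import all_classical all_reals all_analysis.
From mathcomp Require Import measurable_realfun ring lra.
Import Order.TTheory GRing.Theory Num.Theory.
Import numFieldNormedType.Exports.
Set Implicit Arguments.
Unset Strict Implicit.
Unset Printing Implicit Defensive.
Local Open Scope classical_set_scope.
Local Open Scope ring_scope.

(** Let [E(X)] be the Kothe-Bochner space, [f] a unit vector of it and [u] the
    function [`|f|]. Both alternatives on [E] enter through two properties: [E] is
    sluacs+ ([LUR_sluacs_plus]), and the norm of [u * \1_(B n)] tends to 0 when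
    the sets [B n] decrease to the empty set
    ([reflexive_order_continuous], [weak_star_seq_compact_order_continuous]).
    From these and sluacs+ of [X] the property passes to [E(X)]
    ([kothe_bochner_sluacs_plus]), without any description of the dual of [E(X)].

    For unit vectors [g] and functionals [phi] with [`|f + g|] close to 2, we must
    see that if one of [phi f], [phi g] is close to 1 then so is the other. Put
    [v = `|g|] and [w = `|f + g|], and suppose first that [phi g] is close to 1.

    - Scalar part. With [e] the field of directions of [g], the formula
      [psi s = phi (s e)] defines a functional on [E] of norm at most 1 with
      [psi v = phi g] ([scalar_functional]). Since [w <= u + v], sluacs+ of [E]
      gives that [psi u] is close to 1. It gives more: [psi] remains close to 1
      on [u] restricted to the set [G] of the points where [w] is almost [u + v]
      and where neither of [u], [v] is much smaller than the other
      ([comparable_set_concentration]). On [G] the directions [x] of [f] and [e]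
      of [g] satisfy [`|x + e|] close to 2.

    - Pointwise part. By Hahn-Banach in [X], sluacs+ implies a statement about
      norms alone: if [`|x + e|] is close enough to 2, then
      [`|e - tau *: x| <= 1 - tau * (1 - ep)] for small [tau]
      ([sluacs_shortening]). How small [tau] has to be depends on [x], but the set
      of directions for which a given [tau] is admissible is closed; so the
      points [t] with [f t] in it form a measurable set, and order continuity
      makes [u] negligible outside this set for small [tau].

    - Conclusion. The function [u e - tau f] is therefore at most
      [(1 - tau * (1 - ep)) u] on the relevant set, so [phi] is at most
      [1 - tau * (1 - ep)] there; as [phi (u e)] is close to 1, [phi f] must be at
      least about [1 - ep] ([shortened_functional_le]).

    The converse implication is the same argument with the fields of directions
    of [f] and [g] exchanged, comparing [v x] with [g] instead of [u e] with [f].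

    Order continuity is obtained by contradiction. If [E] is reflexive,
    Hahn-Banach for the limit of the norms of restrictions to the [B n], applied
    in [E] and in its dual, gives an element of the bidual concentrated on every
    [B n]; it would come from a function that vanishes. If the dual ball is
    weak*-sequentially compact and the truncations of [u] do not converge,
    disjoint blocks of [u] with norms bounded below yield functionals without
    weak*-convergent subsequence, as in the space of bounded sequences. *)

(** * Hahn-Banach and functionals on a normed space *)

Section hahn_banach.
Context {R : realType} {V : lmodType R} (p : V -> R).
Hypothesis pD : forall x y, p (x + y) <= p x + p y.
Hypothesis pZ : forall a x, p (a *: x) = `|a| * p x.

Let p0 : p 0 = 0.
Proof. by rewrite -(scale0r 0) pZ normr0 mul0r. Qed.

Let pN x : p (- x) = p x.
Proof. by rewrite -scaleN1r pZ normrN1 mul1r. Qed.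

Let p_ge0 x : 0 <= p x.
Proof. by have := pD x (- x); rewrite subrr p0 pN; lra. Qed.

(** Graphs of the linear forms dominated by [p] on a subspace containing [x0],
    with value [p x0] there; the empty set is let in so that the union of the
    empty chain qualifies. *)
Let dominated_graph (x0 : V) (G : set (V * R)) : Prop :=
  [/\ forall a x y r s, G (x, r) -> G (y, s) -> G (a *: x + y, a * r + s),
      forall x r, G (x, r) -> r <= p x &
      forall x r, G (x, r) -> G (x0, p x0)].

(** The one-dimensional extension step: all the lower bounds [s - p (y - x1)]
    for the value at [x1] are below all the upper bounds [p (y + x1) - s]. *)
Let extend x0 G x1 : dominated_graph x0 G -> G (x0, p x0) ->
  (forall r, ~ G (x1, r)) ->
  exists2 G', G `<` G' & dominated_graph x0 G'.
Proof.
move=> [GL Gp G0] Gx0 Gx1.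
have G00 : G (0, 0).
  by have := GL (-1) _ _ _ _ Gx0 Gx0; rewrite scaleN1r addNr mulN1r addNr.
have GZ a x r : G (x, r) -> G (a *: x, a * r).
  by move=> Gx; have := GL a _ _ _ _ Gx G00; rewrite !addr0.
pose L := [set ys.2 - p (ys.1 - x1) | ys in G].
have LU y s z r : G (y, s) -> G (z, r) -> s - p (y - x1) <= p (z + x1) - r.
  move=> Gy Gz; rewrite lerBlDr addrAC lerBrDr.
  have := Gp _ _ (GL 1 _ _ _ _ Gy Gz); rewrite scale1r mul1r => /le_trans; apply.
  have -> : y + z = (z + x1) + (y - x1) by rewrite addrACA subrr addr0 addrC.
  exact: pD.
have L0 : L !=set0 by exists (0 - p (0 - x1)), (0, 0).
have Lub : has_ubound L.
  by exists (p (0 + x1) - 0) => _ [[y s] Gy <-]; exact: LU.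
pose c := sup L.
have cl y s : G (y, s) -> s - c <= p (y - x1).
  move=> Gy; rewrite lerBlDr -lerBlDl; apply: ub_le_sup => //.
  by exists (y, s).
have cu y s : G (y, s) -> s + c <= p (y + x1).
  move=> Gy; rewrite -lerBrDl; apply: ge_sup => // _ [[z r] Gz <-].
  exact: LU.
exists [set xr | exists y s t, [/\ G (y, s), xr.1 = y + t *: x1 &
                                   xr.2 = s + t * c]].
  split.
    by move=> [x r] Gx /=; exists x, r, 0; rewrite scale0r mul0r !addr0.
  move=> /(_ (x1, c)) G1; apply: (Gx1 c); apply: G1.
  by exists 0, 0, 1 => /=; rewrite scale1r mul1r !add0r.
split.
- move=> a x x' r r' [y [s [t [/= Gy -> ->]]]] [y' [s' [t' [/= Gy' -> ->]]]].
  exists (a *: y + y'), (a * s + s'), (a * t + t'); split => /=.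
  + exact: GL.
  + by rewrite scalerDr scalerDl scalerA addrACA.
  + by ring.
- move=> x r [y [s [t [/= Gy -> ->]]]].
  have [t0|t0|->] := ltgtP t 0.
  + have := cl _ _ (GZ (- t)^-1 _ _ Gy).
    have nt0 : 0 < - t by rewrite oppr_gt0.
    move/(ler_wpM2l (ltW nt0)); rewrite mulrBr mulrA divff ?gt_eqF// mul1r.
    rewrite mulNr opprK -{1}(gtr0_norm nt0) -pZ scalerBr scalerA divff ?gt_eqF//.
    by rewrite scale1r scaleNr opprK.
  + have := cu _ _ (GZ t^-1 _ _ Gy).
    move/(ler_wpM2l (ltW t0)); rewrite mulrDr mulrA divff ?gt_eqF// mul1r.
    rewrite -{2}(gtr0_norm t0) -pZ scalerDr scalerA divff ?gt_eqF//.
    by rewrite scale1r.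
  + by rewrite scale0r mul0r !addr0; exact: Gp.
- move=> x r _; exists x0, (p x0), 0 => /=.
  by rewrite scale0r mul0r !addr0.
Qed.

Lemma hahn_banach_seminorm (x0 : V) : exists f : V -> R,
  [/\ forall a x y, f (a *: x + y) = a * f x + f y,
      forall x, `|f x| <= p x & f x0 = p x0].
Proof.
have [F FP Ftot|A [AP Amax]] := @Zorn_bigcup _ (dominated_graph x0).
  split.
  - move=> a x y r s [G FG Gx] [H FH Hy].
    have [GH|HG] := Ftot _ _ FG FH.
      by exists H => //; have [HL _ _] := FP _ FH; apply: HL => //; exact: GH.
    by exists G => //; have [GL _ _] := FP _ FG; apply: GL => //; exact: HG.
  - by move=> x r [G FG Gx]; have [_ Gp _] := FP _ FG; exact: Gp.
  - move=> x r [G FG Gx]; exists G => //.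
    by have [_ _ G0] := FP _ FG; exact: G0 Gx.
have [AL Ap A0] := AP.
have Ax0 : A (x0, p x0).
  have [[[x r] Axr]|/forallNP An] := pselect (exists xr, A xr).
    exact: A0 Axr.
  exfalso; apply: (Amax [set xr | exists a, xr = (a *: x0, a * p x0)]).
    split; first by move=> xr Axr; exfalso; exact: An Axr.
    move=> /(_ (x0, p x0)) A1; apply: (An (x0, p x0)); apply: A1.
    by exists 1; rewrite scale1r mul1r.
  split.
  - move=> a x y r s [b [-> ->]] [c [-> ->]]; exists (a * b + c).
    by rewrite scalerDl scalerA mulrDl mulrA.
  - by move=> x r [a [-> ->]]; rewrite pZ ler_wpM2r// ler_norm.
  - by move=> x r _; exists 1; rewrite scale1r mul1r.
have Adom x : exists r, A (x, r).
  apply: contrapT => /forallNP Ax.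
  have [G AG GP] := extend AP Ax0 Ax; exact: Amax AG GP.
have [f fA] := choice Adom.
have Afun x r s : A (x, r) -> A (x, s) -> r = s.
  have le_ r' s' : A (x, r') -> A (x, s') -> r' <= s'.
    move=> Ar As; have := Ap _ _ (AL (-1) _ _ _ _ As Ar).
    by rewrite scaleN1r addNr p0 mulN1r addrC subr_le0.
  by move=> Ar As; apply/eqP; rewrite eq_le !le_.
have fL a x y : f (a *: x + y) = a * f x + f y.
  by apply: Afun (fA _) _; apply: AL; exact: fA.
exists f; split => // [x|]; last exact: Afun (fA _) Ax0.
rewrite ler_norml (Ap _ _ (fA x)) andbT.
have f0 : f 0 = 0.
  by have := fL (-1) 0 0; rewrite scaler0 addr0 mulN1r addNr.
rewrite -pN lerNl (le_trans _ (Ap (- x) (f (- x)) (fA _)))//.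
by have := fL (-1) x 0; rewrite !addr0 f0 addr0 scaleN1r mulN1r => ->.
Qed.

End hahn_banach.

Section functionals.
Context {R : realType}.
Implicit Types Y : normedModType R.

Lemma dual_of_bounded Y (F : Y -> R) (C : R) : 0 <= C ->
  (forall a x y, F (a *: x + y) = a * F x + F y) ->
  (forall y, `|F y| <= C * `|y|) ->
  exists2 g : dual Y, (forall y, g y = F y) & `|g| <= C.
Proof.
move=> C0 FL FC.
have FB x y : F (x - y) = F x - F y.
  by rewrite addrC -scaleN1r FL mulN1r addrC.
have cF : continuous F.
  move=> x; apply/cvgrPdist_lt => e e0.
  have : 0 < e / (C + 1) by rewrite divr_gt0// ltr_wpDl.
  move=> e1; near=> y.
  rewrite -FB (le_lt_trans (FC _))// (@le_lt_trans _ _ ((C + 1) * `|x - y|))//.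
    by rewrite ler_wpM2r// lerDl.
  rewrite -ltr_pdivlMl ?ltr_wpDl// mulrC.
  by near: y; apply: cvgr_dist_lt.
have FP : F \in @dual_pred R Y by apply/asboolP; split.
exists (Dual FP) => //; apply: dual_norm_le => x x1.
by rewrite (le_trans (FC x))// ler_piMr.
Unshelve. all: by end_near. Qed.

Lemma dual_norm_app Y (g : dual Y) (y : Y) : `|g y| <= `|g| * `|y|.
Proof.
have [->|y0] := eqVneq y 0; first by rewrite dual0 !normr0 mulr0.
have yp : 0 < `|y| by rewrite normr_gt0.
have : `|g (`|y|^-1 *: y)| <= `|g|.
  by apply: dual_sup_ge; rewrite normrZ normfV normr_id mulVf// normr_eq0.
by rewrite dualZ normrM normfV normr_id mulrC ler_pdivrMr.
Qed.

Lemma dual_app_le Y (g : dual Y) (y : Y) r : `|g| <= 1 -> `|y| <= r -> g y <= r.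
Proof.
move=> g1 yr; rewrite (le_trans (ler_norm _))// (le_trans (dual_norm_app _ _))//.
by rewrite (le_trans _ yr)// ler_piMl.
Qed.

Lemma dualD Y (g : dual Y) (x y : Y) : g (x + y) = g x + g y.
Proof. by rewrite -{1}(scale1r x) dual_linear mul1r. Qed.

Lemma dualB Y (g : dual Y) (x y : Y) : g (x - y) = g x - g y.
Proof. by rewrite addrC -scaleN1r dual_linear mulN1r addrC. Qed.

Lemma norming_functional Y (y : Y) : exists2 g : dual Y, `|g| <= 1 & g y = `|y|.
Proof.
have [||f [fL fle fy]] := @hahn_banach_seminorm R Y (fun x => `|x|) _ _ y.
- exact: ler_normD.
- exact: normrZ.
have [|g gE g1] := @dual_of_bounded Y f 1 ler01 fL.
  by move=> x; rewrite mul1r.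
by exists g => //; rewrite gE.
Qed.

End functionals.

(** * The property sluacs+ without sequences *)

Section local_modulus.
Context {R : realType}.
Implicit Types Y : normedModType R.

(** The epsilon-delta form of sluacs+ at [x]; vectors and functionals range over
    the balls instead of the spheres, so that truncated vectors and functionals
    may be used without normalizing them. *)
Definition sluacs_at Y (x : Y) : Prop := forall e, 0 < e ->
  exists2 d : R, 0 < d & forall (y : Y) (g : dual Y),
    `|y| <= 1 -> `|g| <= 1 -> 2 - d < `|x + y| ->
    (1 - d <= g y -> 1 - e <= g x) /\ (1 - d <= g x -> 1 - e <= g y).

Let cvg_to1 (a : nat -> R) : (forall n, 1 - n.+2%:R^-1 <= a n <= 1) ->
  a n @[n --> \oo] --> (1 : R).
Proof.
move=> a1; apply: (@squeeze_cvgr _ _ _ _ (fun n => 1 - n.+2%:R^-1) (cst 1)).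
- exact: nearW.
- rewrite -[X in _ --> X]subr0; apply: cvgB; first exact: cvg_cst.
  have := @cvg_harmonic R; by rewrite -(cvg_shiftS (harmonic : nat -> R^o)).
- exact: cvg_cst.
Qed.

Let eq_cvgn (a b : nat -> R) (l l' : R) :
  a n @[n --> \oo] --> l -> l = l' -> a =1 b -> b n @[n --> \oo] --> l'.
Proof. by move=> + <- /funext <-. Qed.

(** Normalization turns sequences with norms tending to 1 into sequences on the
    spheres. *)
Let sluacs_plus_normalized Y (x : Y) (y_ : nat -> Y) (g_ : nat -> dual Y) :
  sluacs_plus Y -> `|x| = 1 ->
  (forall n, `|y_ n| != 0) -> (forall n, `|g_ n| != 0) ->
  `|y_ n| @[n --> \oo] --> (1 : R) -> `|g_ n| @[n --> \oo] --> (1 : R) ->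
  `|y_ n + x| @[n --> \oo] --> (2 : R) ->
  (g_ n (y_ n) @[n --> \oo] --> (1 : R) <-> g_ n x @[n --> \oo] --> (1 : R)).
Proof.
move=> sY x1 y0 g0 y1 g1 yx2.
pose z n := `|y_ n|^-1 *: y_ n; pose h n := `|g_ n|^-1 *: g_ n.
have z1 n : `|z n| = 1 by rewrite normrZ normfV normr_id mulVf.
have h1 n : `|h n| = 1 by rewrite normrZ normfV normr_id mulVf.
have vy : `|y_ n|^-1 @[n --> \oo] --> (1 : R).
  by rewrite -[X in _ --> X]invr1; apply: cvgV => //; exact: oner_neq0.
have vg : `|g_ n|^-1 @[n --> \oo] --> (1 : R).
  by rewrite -[X in _ --> X]invr1; apply: cvgV => //; exact: oner_neq0.
have zx2 : `|z n + x| @[n --> \oo] --> (2 : R).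
  have zy : `|z n + x| - `|y_ n + x| @[n --> \oo] --> (0 : R).
    have d0 : `|1 - `|y_ n| | @[n --> \oo] --> (0 : R).
      have : 1 - `|y_ n| @[n --> \oo] --> (1 - 1 : R).
        by apply: cvgB => //; exact: cvg_cst.
      by rewrite subrr => /cvg_norm; rewrite normr0.
    apply: (@squeeze_cvgr _ _ _ _ (fun n => - `|1 - `|y_ n| |)
        (fun n => `|1 - `|y_ n| |)).
    - apply: nearW => n; rewrite -ler_norml (le_trans (ler_dist_dist _ _))//.
      rewrite opprD addrACA subrr addr0 -[X in _ - X]scale1r -scalerBl normrZ.
      by rewrite -{2}(normr_id (y_ n)) -normrM mulrBl mulVf// mul1r.
    - by rewrite -oppr0; exact: cvgN.
    - exact: d0.
  apply: eq_cvgn (cvgD zy yx2) _ _;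
    [by rewrite add0r|
     by move=> n /=; rewrite subrK].
have [zP xP] := sY x z h x1 z1 zx2 h1.
split=> [gy|gx].
- have /zP hx : h n (z n) @[n --> \oo] --> (1 : R).
    apply: eq_cvgn (cvgM (cvgM vg vy) gy) _ _; first by rewrite !mul1r.
    by move=> n; change ((`|g_ n|^-1 * `|y_ n|^-1) * g_ n (y_ n) =
      `|g_ n|^-1 * g_ n (z n)); rewrite dualZ mulrA.
  apply: eq_cvgn (cvgM g1 hx) _ _;
    [by rewrite mul1r|
     by move=> n; change (`|g_ n| * (`|g_ n|^-1 * g_ n x) = g_ n x);
      rewrite mulrA divff ?mul1r].
- have /xP hx : h n x @[n --> \oo] --> (1 : R).
    by apply: eq_cvgn (cvgM vg gx) _ _; first by rewrite mul1r.
  apply: eq_cvgn (cvgM (cvgM y1 g1) hx) _ _;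
    [by rewrite !mul1r|
     by move=> n; change (`|y_ n| * `|g_ n| * (`|g_ n|^-1 * g_ n (z n)) =
       g_ n (y_ n)); rewrite dualZ;
  by rewrite mulrA -(mulrA `|y_ n|) divff// mulr1 mulrA divff ?mul1r].
Qed.

Lemma sluacs_plus_at Y (x : Y) : sluacs_plus Y -> `|x| = 1 -> sluacs_at x.
Proof.
move=> sY x1 e e0.
(* Failure for the tolerances 1 / (n + 2), with [P] one of the two pairings
   required to be close to 1. *)
have bad (P Q : Y -> dual Y -> R) :
    (forall y g, `|y| <= 1 -> `|g| <= 1 -> P y g <= `|g|) ->
    (forall y_ g_, (forall n, `|y_ n| != 0) -> (forall n, `|g_ n| != 0) ->
      `|y_ n| @[n --> \oo] --> (1 : R) -> `|g_ n| @[n --> \oo] --> (1 : R) ->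
      `|y_ n + x| @[n --> \oo] --> (2 : R) ->
      P (y_ n) (g_ n) @[n --> \oo] --> (1 : R) ->
      Q (y_ n) (g_ n) @[n --> \oo] --> (1 : R)) ->
    exists2 d : R, 0 < d & forall y g, `|y| <= 1 -> `|g| <= 1 ->
      2 - d < `|x + y| -> 1 - d <= P y g -> 1 - e <= Q y g.
  move=> Pg PQ; apply: contrapT => nd.
  have : forall n, exists yg : Y * dual Y, [/\ `|yg.1| <= 1, `|yg.2| <= 1,
      2 - n.+2%:R^-1 < `|x + yg.1|, 1 - n.+2%:R^-1 <= P yg.1 yg.2 &
      Q yg.1 yg.2 < 1 - e].
    move=> n; apply: contrapT => /forallNP nyg; apply: nd.
    exists n.+2%:R^-1 => [|y g y1 g1 xy Py]; first by rewrite invr_gt0.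
    rewrite leNgt; apply/negP => Qy; exact: (nyg (y, g)).
  move=> /choice[yg ygP].
  have d1 n : n.+2%:R^-1 < 1 :> R by rewrite invf_lt1// ltr1n.
  have y1 n : 1 - n.+2%:R^-1 <= `|(yg n).1| <= 1.
    have [-> _ + _ _] := ygP n; rewrite andbT => /ltW.
    move=> /le_trans/(_ (ler_normD _ _)); rewrite x1.
    move: (n.+2%:R^-1) `|_| => r s; lra.
  have g1 n : 1 - n.+2%:R^-1 <= `|(yg n).2| <= 1.
    have [h1 h2 _ h3 _] := ygP n.
    by rewrite h2 andbT (le_trans h3)// Pg.
  have : Q (yg n).1 (yg n).2 @[n --> \oo] --> (1 : R).
    apply: PQ.
    - move=> n; have /andP[y1n _] := y1 n; rewrite gt_eqF//.
      by apply: lt_le_trans y1n; rewrite subr_gt0.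
    - move=> n; have /andP[g1n _] := g1 n; rewrite gt_eqF//.
      by apply: lt_le_trans g1n; rewrite subr_gt0.
    - exact: cvg_to1.
    - exact: cvg_to1.
    - suff : `|(yg n).1 + x| - 1 @[n --> \oo] --> (1 : R).
        have h1 : (1 : R) @[_ --> \oo] --> (1 : R) by exact: cvg_cst.
        by move=> h; apply: eq_cvgn (cvgD h h1) _ _ => // n; rewrite /= subrK.
      apply: cvg_to1 => n; have [h1 _ + _ _] := ygP n.
      have := ler_normD (yg n).1 x; rewrite x1 addrC.
      move: (n.+2%:R^-1) `|x + _| `|(yg n).1| h1 => r s t; lra.
    - apply: cvg_to1 => n; have [h1 h2 _ -> _] := ygP n.
      by rewrite (le_trans (Pg _ _ h1 h2)).
  move/cvgr_dist_lt => /(_ _ e0) [n _ /(_ n (leqnn _))] /=.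
  have [_ _ _ _ + ] := ygP n; rewrite ltr_norml => Qe /andP[_].
  by move: (Q _ _) Qe => q; lra.
have [||d d0 dP] := bad (fun y g => g y) (fun y g => g x).
- move=> y g y1 _; rewrite (le_trans (ler_norm _))//.
  by rewrite (le_trans (dual_norm_app _ _))// ler_piMr.
- move=> y_ g_ y0 g0 y1 g1 yx.
  by have [] := sluacs_plus_normalized sY x1 y0 g0 y1 g1 yx.
have [||d' d'0 d'P] := bad (fun y g => g x) (fun y g => g y).
- move=> y g y1 _; rewrite (le_trans (ler_norm _))//.
  by rewrite (le_trans (dual_norm_app _ _))// x1 mulr1.
- move=> y_ g_ y0 g0 y1 g1 yx.
  by have [] := sluacs_plus_normalized sY x1 y0 g0 y1 g1 yx.
exists (Num.min d d'); first by rewrite lt_min d0.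
move=> y g y1 g1; have [md md'] : Num.min d d' <= d /\ Num.min d d' <= d'.
  by rewrite !ge_min !lexx orbT.
move: (Num.min _ _) md md' => m md md' xy; split=> gm.
  by apply: (dP y) => //; lra.
by apply: (d'P y) => //; lra.
Qed.

Lemma sluacs_at_plus Y : (forall x : Y, `|x| = 1 -> sluacs_at x) ->
  sluacs_plus Y.
Proof.
move=> sY x x_ g_ x1 xn1 xx2 gn1.
have g_le1 (a : nat -> Y) : (forall n, `|a n| = 1) ->
    (forall e, 0 < e -> \forall n \near \oo, 1 - e <= g_ n (a n)) ->
    g_ n (a n) @[n --> \oo] --> (1 : R).
  move=> a1 ae; apply/cvgrPdist_le => e e0; apply: filterS (ae _ e0) => n en.
  have : g_ n (a n) <= 1 by apply: dual_app_le; rewrite ?gn1 ?a1.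
  by move=> ?; rewrite ger0_norm; lra.
have near1 (d : R) (a : nat -> R) : 0 < d -> a n @[n --> \oo] --> (1 : R) ->
    \forall n \near \oo, 1 - d <= a n.
  move=> d0 /cvgr_dist_lt /(_ _ d0); apply: filterS => n.
  by rewrite ltr_norml => /andP[_]; lra.
have near2 (d : R) : 0 < d -> \forall n \near \oo, 2 - d < `|x + x_ n|.
  move=> d0; move/cvgr_dist_lt : xx2 => /(_ _ d0); apply: filterS => n.
  by rewrite ltr_norml (addrC x) => /andP[_]; lra.
split=> g1.
- apply: (g_le1 (cst x)) => // e e0; have [d d0 dP] := sY x x1 e e0.
  apply: filterS2 (near1 _ _ d0 g1) (near2 _ d0) => n h1 h2.
  by apply: (dP (x_ n) (g_ n) _ _ h2).1 => //; rewrite ?xn1 ?gn1.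
- apply: g_le1 => // e e0; have [d d0 dP] := sY x x1 e e0.
  apply: filterS2 (near1 _ _ d0 g1) (near2 _ d0) => n h1 h2.
  by apply: (dP (x_ n) (g_ n) _ _ h2).2 => //; rewrite ?xn1 ?gn1.
Qed.

Lemma LUR_sluacs_plus Y : LUR Y -> sluacs_plus Y.
Proof.
move=> lY x x_ g_ x1 xn1 xx2 gn1.
have xx0 : g_ n (x_ n) - g_ n x @[n --> \oo] --> (0 : R).
  apply/norm_cvg0P.
  apply: (@squeeze_cvgr _ _ _ _ (cst 0) (fun n => `|x_ n - x|)).
  - apply: nearW => n; rewrite normr_ge0 -dualB (le_trans (dual_norm_app _ _))//.
    by rewrite gn1 mul1r.
  - exact: cvg_cst.
  - exact: lY.
split=> h.
- apply: eq_cvgn (cvgB h xx0) _ _;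
    [by rewrite subr0|
     by move=> n /=; rewrite opprB addrC subrK].
- apply: eq_cvgn (cvgD xx0 h) _ _;
    [by rewrite add0r|
     by move=> n /=; rewrite subrK].
Qed.

(** The primal form of sluacs+: if [`|x + y|] is almost 2, then moving [y] by
    [- d *: x] shortens it at almost the maximal rate, and likewise with [x] and
    [y] exchanged. It speaks of norms only, so it can be applied pointwise to
    vector-valued functions. *)
Lemma sluacs_shortening Y (x : Y) : sluacs_plus Y -> `|x| = 1 ->
  forall e, 0 < e -> exists2 d0 : R, 0 < d0 & forall d, 0 < d -> d <= d0 ->
    forall y, `|y| <= 1 -> 2 - d < `|x + y| ->
    `|y - d *: x| <= 1 - d * (1 - e) /\ `|x - d *: y| <= 1 - d * (1 - e).
Proof.
move=> sY x1 e e0; have [d d_gt0 dP] := sluacs_plus_at sY x1 e0.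
(* A functional below [1 - d] on one of the vectors stays below [1 - t] on the
   difference if [t <= d / 2]; any other one is almost 1 on both vectors. *)
exists (d / 2); first by rewrite divr_gt0.
move=> t t0 td y y1 xy; have xy' : 2 - d < `|x + y| by lra.
split.
- have [g g1 <-] := norming_functional (y - t *: x).
  have [gyx _] := dP y g y1 g1 xy'.
  have gy := dual_app_le g1 y1.
  have gx : - g x <= 1.
    have := @dual_app_le R Y g (- x) 1 g1; rewrite normrN x1 lexx.
    by rewrite -scaleN1r dualZ mulN1r; apply.
  rewrite dualB dualZ.
  have [/gyx gx1|gy1] := leP (1 - d) (g y); first nra.
  nra.
- have [g g1 <-] := norming_functional (x - t *: y).
  have [_ gxy] := dP y g y1 g1 xy'.
  have gx : g x <= 1 by apply: dual_app_le => //; rewrite x1.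
  have gy : - g y <= 1.
    have := @dual_app_le R Y g (- y) 1 g1; rewrite normrN.
    by rewrite -scaleN1r dualZ mulN1r; apply.
  rewrite dualB dualZ.
  have [/gxy gy1|gx1] := leP (1 - d) (g x); first nra.
  nra.
Qed.

End local_modulus.

(** * Restriction to measurable sets in a Kothe function space *)

(** Facts that hold almost everywhere are turned one by one into premises of the
    pointwise goal, as many as needed. *)
Ltac ae_use H := apply: (filter_app _ _ H).

Section kothe_lattice.
Context d (T : measurableType d) (R : realType).
Context (mu : {measure set T -> \bar R}) (E : kothe_space mu).
Implicit Types (u v w : E) (G H : set T).

Lemma kothe_le u v :
  (\forall t \ae mu, `|kothe_rep u t| <= `|kothe_rep v t|) -> `|u| <= `|v|.
Proof.
move=> uv; have [w wu wv] := kothe_ideal (kothe_measurable u) uv.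
by rewrite -(kothe_inj wu).
Qed.

Lemma kothe_eq u v :
  (\forall t \ae mu, kothe_rep u t = kothe_rep v t) -> u = v.
Proof. by move=> uv; apply: kothe_inj; ae_use uv; apply: aeW => t + _. Qed.

Lemma kothe_linearE (a : R) u v : \forall t \ae mu,
  kothe_rep (a *: u + v) t = a * kothe_rep u t + kothe_rep v t.
Proof. by ae_use (kothe_linear a u v); apply: aeW => t; apply. Qed.

Lemma kothe_addE u v : \forall t \ae mu,
  kothe_rep (u + v) t = kothe_rep u t + kothe_rep v t.
Proof. by ae_use (kothe_repD u v); apply: aeW => t; apply. Qed.

Lemma kothe_scaleE (a : R) u : \forall t \ae mu,
  kothe_rep (a *: u) t = a * kothe_rep u t.
Proof. by ae_use (kothe_repZ a u); apply: aeW => t; apply. Qed.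

Lemma kothe_le_of_measurable (g : T -> R) u : measurable_fun setT g ->
  (\forall t \ae mu, `|g t| <= `|kothe_rep u t|) ->
  exists v, \forall t \ae mu, kothe_rep v t = g t.
Proof.
move=> mg gu; have [v vg _] := kothe_ideal mg gu; exists v.
by ae_use vg; apply: aeW => t; apply.
Qed.

Lemma kothe_restr_ex G u : exists v, measurable G ->
  \forall t \ae mu, kothe_rep v t = \1_G t * kothe_rep u t.
Proof.
have [mG|] := pselect (measurable G); last by exists 0.
have [||v vE] := @kothe_le_of_measurable (fun t => \1_G t * kothe_rep u t) u.
- by apply: measurable_funM => //; exact: kothe_measurable.
- apply: aeW => t; rewrite indicE normrM; case: (t \in G).
    by rewrite normr1 mul1r.
  by rewrite normr0 mul0r.
by exists v.
Qed.

(** The element [u * \1_G]; a junk value when [G] is not measurable. *)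
Definition kothe_restr G u : E := projT1 (cid (kothe_restr_ex G u)).

Lemma kothe_restrE G u : measurable G ->
  \forall t \ae mu, kothe_rep (kothe_restr G u) t = \1_G t * kothe_rep u t.
Proof. exact: projT2 (cid (kothe_restr_ex G u)). Qed.

Lemma kothe_restr_linear G (a : R) u v : measurable G ->
  kothe_restr G (a *: u + v) = a *: kothe_restr G u + kothe_restr G v.
Proof.
move=> mG; apply: kothe_eq.
ae_use (kothe_restrE (a *: u + v) mG).
ae_use (kothe_linearE a (kothe_restr G u) (kothe_restr G v)).
ae_use (kothe_restrE u mG); ae_use (kothe_restrE v mG).
ae_use (kothe_linearE a u v).
by apply: aeW => t -> -> -> -> ->; rewrite mulrDr mulrCA.
Qed.

Lemma kothe_restrD G u v : measurable G ->
  kothe_restr G (u + v) = kothe_restr G u + kothe_restr G v.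
Proof.
by move=> mG; have := kothe_restr_linear 1 u v mG; rewrite !scale1r.
Qed.

Lemma kothe_restrZ G (a : R) u : measurable G ->
  kothe_restr G (a *: u) = a *: kothe_restr G u.
Proof.
move=> mG; apply: kothe_eq.
ae_use (kothe_restrE (a *: u) mG); ae_use (kothe_restrE u mG).
ae_use (kothe_scaleE a u); ae_use (kothe_scaleE a (kothe_restr G u)).
by apply: aeW => t -> -> -> ->; rewrite mulrCA.
Qed.

Lemma kothe_restr_le G H u : measurable G -> measurable H -> G `<=` H ->
  `|kothe_restr G u| <= `|kothe_restr H u|.
Proof.
move=> mG mH GH; apply: kothe_le.
ae_use (kothe_restrE u mG); ae_use (kothe_restrE u mH).
apply: aeW => t -> ->; rewrite !normrM ler_wpM2r// !indicE.
have [tG|_] := boolP (t \in G); last by rewrite normr0.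
by rewrite (mem_set (GH _ (set_mem tG))).
Qed.

Lemma kothe_restrT u : kothe_restr setT u = u.
Proof.
apply: kothe_eq; ae_use (kothe_restrE u measurableT).
by apply: aeW => t ->; rewrite indicT mul1r.
Qed.

Lemma kothe_restr0 u : kothe_restr set0 u = 0.
Proof.
apply: kothe_eq; ae_use (kothe_restrE u measurable0).
ae_use (@kothe_rep0 _ _ _ _ E).
by apply: aeW => t /(_ I) -> ->; rewrite indic0 mul0r.
Qed.

Lemma kothe_restr_norm G u : measurable G -> `|kothe_restr G u| <= `|u|.
Proof.
by move=> mG; rewrite -[leRHS](congr1 _ (kothe_restrT u)) kothe_restr_le.
Qed.

Lemma kothe_restrI G H u : measurable G -> measurable H ->
  kothe_restr G (kothe_restr H u) = kothe_restr (G `&` H) u.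
Proof.
move=> mG mH; apply: kothe_eq.
ae_use (kothe_restrE (kothe_restr H u) mG); ae_use (kothe_restrE u mH).
ae_use (kothe_restrE u (measurableI _ _ mG mH)).
by apply: aeW => t -> -> ->; rewrite indicI mulrA.
Qed.

Lemma kothe_restrU G H u : measurable G -> measurable H -> G `&` H = set0 ->
  kothe_restr (G `|` H) u = kothe_restr G u + kothe_restr H u.
Proof.
move=> mG mH GH; apply: kothe_eq.
ae_use (kothe_restrE u mG); ae_use (kothe_restrE u mH).
ae_use (kothe_restrE u (measurableU _ _ mG mH)).
ae_use (kothe_addE (kothe_restr G u) (kothe_restr H u)).
apply: aeW => t -> -> -> ->; rewrite -mulrDl !indicE in_setU.
have [tG|_] := boolP (t \in G); last by rewrite add0r.
have [tH|_] := boolP (t \in H); last by rewrite addr0.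
have : (G `&` H) t by split; exact: set_mem.
by rewrite GH.
Qed.

Lemma kothe_restrC G u : measurable G ->
  u = kothe_restr G u + kothe_restr (~` G) u.
Proof.
move=> mG; rewrite -kothe_restrU ?setICr ?setUv ?kothe_restrT//.
exact: measurableC.
Qed.

Lemma kothe_restrID G H u : measurable G -> measurable H ->
  kothe_restr G u = kothe_restr (G `&` H) u + kothe_restr (G `&` ~` H) u.
Proof.
move=> mG mH; have mH' := measurableC mH.
rewrite {1}(kothe_restrC u mH) kothe_restrD// kothe_restrI//.
by rewrite kothe_restrI.
Qed.

Lemma dual_restr (psi : dual E) G : measurable G ->
  exists2 g : dual E, (forall s, g s = psi (kothe_restr G s)) & `|g| <= `|psi|.
Proof.
move=> mG; apply: (@dual_of_bounded R E (psi \o kothe_restr G)) => //.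
- by move=> a x y; rewrite /= kothe_restr_linear// dual_linear.
- move=> y; rewrite (le_trans (dual_norm_app _ _))// ler_wpM2l//.
  exact: kothe_restr_norm.
Qed.

End kothe_lattice.

(** * Concentration of almost norming functionals *)

Section concentration.
Context d (T : measurableType d) (R : realType).
Context (mu : {measure set T -> \bar R}) (E : kothe_space mu).
Context (u : E) (su : sluacs_at u) (u1 : `|u| = 1).
Context (u0 : \forall t \ae mu, 0 <= kothe_rep u t).

Let psi_u e : 0 < e -> exists2 dl : R, 0 < dl & forall (v : E) (psi : dual E),
  `|v| <= 1 -> `|psi| <= 1 -> 2 - dl < `|u + v| ->
  1 - dl <= psi u \/ 1 - dl <= psi v -> 1 - e <= psi u.
Proof.
move=> e0; have [dl dl0 dlP] := su e0.
exists (Num.min dl e); first by rewrite lt_min dl0.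
move=> v psi v1 psi1.
have [le1 le2] : Num.min dl e <= dl /\ Num.min dl e <= e.
  by split; rewrite ge_min lexx ?orbT.
move: (Num.min _ _) le1 le2 => m le1 le2 uv [psiu|psiv]; first by lra.
by apply: (dlP v psi v1 psi1 _).1; lra.
Qed.

Definition level_set (eta : R) (v w : E) : set T :=
  [set t | (1 - eta) * (kothe_rep u t + kothe_rep v t) <= kothe_rep w t].

Lemma measurable_level_set eta v w : measurable (level_set eta v w).
Proof.
have mk := @kothe_measurable _ _ _ _ E.
rewrite -[level_set _ _ _]setTI; apply: measurable_fun_ler => //.
by apply: measurable_funM => //; apply: measurable_funD.
Qed.

(** Let [w'] be [u + v], lowered to [(1 - eta) (u + v)] off the level set. It is
    still above [w], so its norm is almost 2; hence [w' / 2] is almost flat with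
    [u], and [psi] is almost 1 on it by sluacs+. So the lowering has cost [psi]
    little. *)
Lemma level_set_concentration e eta : 0 < e -> 0 < eta -> eta <= 1 ->
  exists2 dl : R, 0 < dl & forall (v w : E) (psi : dual E),
    `|v| <= 1 -> `|psi| <= 1 ->
    (\forall t \ae mu, 0 <= kothe_rep w t <= kothe_rep u t + kothe_rep v t) ->
    2 - dl < `|w| -> 1 - dl <= psi u \/ 1 - dl <= psi v ->
    1 - e <= psi (kothe_restr (level_set eta v w) u).
Proof.
move=> e0 eta0 eta1.
have ee0 : 0 < eta * e / 2 by rewrite divr_gt0// mulr_gt0.
have [d2 d20 d2P] := su ee0.
have [d1 d10 d1P] := psi_u d20.
exists (Num.min d1 (d2 / 2)); first by rewrite lt_min d10 divr_gt0.
move=> v w psi v1 psi1 wuv.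
have [le1 le2] : Num.min d1 (d2 / 2) <= d1 /\ Num.min d1 (d2 / 2) <= d2 / 2.
  by split; rewrite ge_min lexx ?orbT.
move: (Num.min _ _) le1 le2 => dl le1 le2 w2 psiuv.
set G := level_set _ _ _; have mG : measurable G := measurable_level_set _ _ _.
have w_uv : `|w| <= `|u + v|.
  apply: kothe_le; ae_use wuv; ae_use (kothe_addE u v).
  by apply: aeW => t -> /andP[h1 h2]; rewrite !ger0_norm// (le_trans h1).
have uv2 : `|u + v| <= 2 by rewrite (le_trans (ler_normD _ _))// u1; lra.
have psiu : 1 - d2 <= psi u.
  apply: (d1P v) => //; first by lra.
  by case: psiuv => ?; [left|right]; lra.
pose r := kothe_restr G (u + v).
pose w' := (1 - eta) *: (u + v) + eta *: r.
have w'E : \forall t \ae mu, 0 <= kothe_rep w t <= kothe_rep w' t /\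
    kothe_rep w' t <= kothe_rep (u + v) t.
  ae_use wuv; ae_use (kothe_addE u v).
  ae_use (kothe_linearE (1 - eta) (u + v) (eta *: r)).
  ae_use (kothe_scaleE eta r); ae_use (kothe_restrE (u + v) mG).
  apply: aeW => t rE -> -> uvE /andP[wt0 wt]; rewrite wt0 /=.
  rewrite rE uvE indicE; have [tG|tG] := boolP (t \in G).
    by rewrite mul1r; split; nra.
  have : ~ G t by move=> /mem_set Gt; rewrite Gt in tG.
  rewrite mul0r.
  by rewrite /G /level_set /= => /negP; rewrite -ltNge => ?; split; nra.
have w'_ge : `|w| <= `|w'|.
  apply: kothe_le; ae_use w'E; apply: aeW => t [/andP[h1 h2] _].
  by rewrite !ger0_norm// (le_trans h1).
have w'2 : `|w'| <= 2.
  apply: le_trans uv2; apply: kothe_le; ae_use w'E.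
  apply: aeW => t [/andP[h1 h2] h3].
  by rewrite !ger0_norm ?(le_trans h1)// (le_trans h2).
(* Next, [u + 2^-1 *: w'] has norm almost 2 by the triangle inequality, since
   [u + v + w'] dominates [2 *: w']. *)
have w'3 : 2 * `|w'| <= `|u + v + w'|.
  have -> : 2 * `|w'| = `|2 *: w'| by rewrite normrZ ger0_norm.
  apply: kothe_le; ae_use w'E; ae_use (kothe_scaleE 2 w').
  ae_use (kothe_addE (u + v) w').
  by apply: aeW => t -> -> [/andP[h1 h2] h3]; rewrite !ger0_norm; lra.
have y1 : `|2^-1 *: w'| <= 1 by rewrite normrZ ger0_norm//; lra.
have uy : 2 - d2 < `|u + 2^-1 *: w'|.
  have h1 := ler_normD (u + 2^-1 *: w' + (u + 2^-1 *: w')) w'.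
  have h2 := ler_normD (u + w') v.
  have h3 := ler_normD (u + 2^-1 *: w') (u + 2^-1 *: w').
  have e1 : u + w' + v = u + v + w' by rewrite addrAC.
  have e2 (a b : E) : a + 2^-1 *: b + (a + 2^-1 *: b) + b = 2 *: (a + b).
    rewrite -mulr2n -scaler_nat [2 *: (a + _)]scalerDr scalerA divff// scale1r.
    by rewrite -addrA -[b + b]mulr2n -[b *+ 2]scaler_nat -scalerDr.
  have e3 : `|2 *: (u + w')| = 2 * `|u + w'| by rewrite normrZ ger0_norm.
  rewrite e1 in h2; rewrite e2 e3 in h1; lra.
have := (d2P _ psi y1 psi1 uy).2 psiu.
rewrite dualZ /w' dual_linear dualZ /r kothe_restrD// !dualD.
have psiu1 : psi u <= 1 by apply: dual_app_le => //; rewrite u1.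
have psiv1 : psi v <= 1 by apply: dual_app_le.
have psirv : psi (kothe_restr G v) <= 1.
  by apply: dual_app_le => //; rewrite (le_trans _ v1)// kothe_restr_norm.
move: (psi u) (psi v) (psi (kothe_restr G v)) psiu1 psiv1 psirv.
move=> a b q a1 b1 q1.
move: (psi (kothe_restr G u)) => p.
move=> h; have {}h : eta * (1 - e) <= eta * p by nra.
by rewrite ler_pM2l in h.
Qed.

Definition comparable_set (eta c : R) (v w : E) : set T :=
  level_set eta v w `&` [set t | c * kothe_rep u t < kothe_rep v t] `&`
  [set t | c * kothe_rep v t < kothe_rep u t].

Let mcomp c (v w : E) :
  measurable [set t | c * kothe_rep v t < kothe_rep w t].
Proof.
rewrite -[X in measurable X]setTI; apply: measurable_fun_ltr => //.
- by apply: measurable_funM => //; exact: kothe_measurable.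
- exact: kothe_measurable.
Qed.

Lemma measurable_comparable_set eta c v w :
  measurable (comparable_set eta c v w).
Proof.
by do 2?apply: measurableI => //; [exact: measurable_level_set|exact: mcomp..].
Qed.

Let restr_small (c : R) (v w : E) : 0 < c -> `|v| <= 1 ->
  (\forall t \ae mu, 0 <= kothe_rep w t) ->
  forall G, measurable G ->
  `|kothe_restr (G `&` ~` [set t | c * kothe_rep v t < kothe_rep w t]) w| <= c.
Proof.
move=> c0 v1 w0 G mG; set A := [set t | _].
have mA : measurable A := mcomp _ _ _.
have mGA : measurable (G `&` ~` A).
  by apply: measurableI => //; exact: measurableC.
apply: (@le_trans _ _ `|c *: v|); last first.
  by rewrite normrZ gtr0_norm// ler_piMr// ltW.
apply: kothe_le; ae_use w0; ae_use (kothe_restrE w mGA).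
ae_use (kothe_scaleE c v); apply: aeW => t -> -> w0t.
rewrite indicE; have [tGA|_] := boolP (t \in G `&` ~` A); last first.
  by rewrite mul0r normr0.
have [_ /negP] := set_mem tGA; rewrite -leNgt mul1r => wcv.
by rewrite ger0_norm// (le_trans wcv)// ler_norm.
Qed.

(** Removing the set where one of [u], [v] is much smaller than the other costs
    [psi] little on the small one in norm, hence on the other one by sluacs+. *)
Lemma comparable_set_concentration e : 0 < e ->
  exists2 c : R, 0 < c & forall eta, 0 < eta -> eta <= 1 ->
  exists2 dl : R, 0 < dl & forall (v w : E) (psi : dual E),
    `|v| <= 1 -> `|psi| <= 1 ->
    (\forall t \ae mu, 0 <= kothe_rep v t) ->
    (\forall t \ae mu, 0 <= kothe_rep w t <= kothe_rep u t + kothe_rep v t) ->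
    2 - dl < `|w| -> 1 - dl <= psi u \/ 1 - dl <= psi v ->
    1 - e <= psi (kothe_restr (comparable_set eta c v w) u) /\
    1 - e <= psi (kothe_restr (comparable_set eta c v w) v).
Proof.
move=> e0; have [da da0 daP] := su e0.
pose e1 := Num.min e da / 2.
have e10 : 0 < e1 by rewrite divr_gt0// lt_min e0.
have [db db0 dbP] := su e10.
have db20 : 0 < db / 2 by rewrite divr_gt0.
have [c c0 [ce1 cdb]] : exists2 c : R, 0 < c & c <= e1 /\ c <= db / 2.
  exists (Num.min e1 (db / 2)); first by rewrite lt_min e10.
  by split; rewrite ge_min lexx ?orbT.
exists c => // eta eta0 eta1.
have [dl dl0 dlP] := level_set_concentration db20 eta0 eta1.
exists (Num.min dl (Num.min da db)); first by rewrite !lt_min dl0 da0.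
have [m1 m2] : Num.min dl (Num.min da db) <= dl /\
    Num.min dl (Num.min da db) <= Num.min da db.
  by split; rewrite ge_min lexx ?orbT.
have [m3 m4] : Num.min da db <= da /\ Num.min da db <= db.
  by split; rewrite ge_min lexx ?orbT.
move: (Num.min dl _) m1 m2 => m m1 m2 v w psi v1 psi1 v0 wuv w2 psiuv.
have w_uv : `|w| <= `|u + v|.
  apply: kothe_le; ae_use wuv; ae_use (kothe_addE u v).
  by apply: aeW => t -> /andP[h1 h2]; rewrite !ger0_norm// (le_trans h1).
rewrite /comparable_set; set L := level_set _ _ _.
set A := [set t | c * kothe_rep u t < _]; set B := [set t | _].
have mL : measurable L by exact: measurable_level_set.
have [mA mB] : measurable A /\ measurable B by split; exact: mcomp.
have mLB : measurable (L `&` B) by exact: measurableI.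
rewrite setIAC.
have mLBA : measurable (L `&` B `&` A) by exact: measurableI.
have psiL : 1 - db / 2 <= psi (kothe_restr L u).
  apply: dlP => //; first by lra.
  by case: psiuv => ?; [left|right]; lra.
have psiLBu : 1 - db <= psi (kothe_restr (L `&` B) u).
  have : psi (kothe_restr (L `&` ~` B) u) <= c.
    by apply: dual_app_le => //; exact: restr_small.
  by move: psiL; rewrite (kothe_restrID u mL mB) dualD; lra.
have psiLBv : 1 - e1 <= psi (kothe_restr (L `&` B) v).
  have [g gE g1] := dual_restr psi mLB.
  rewrite -gE; apply: (dbP v g v1 (le_trans g1 psi1) _).2; first by lra.
  by rewrite gE.
have psiLBAv : 1 - Num.min e da <= psi (kothe_restr (L `&` B `&` A) v).
  have : psi (kothe_restr (L `&` B `&` ~` A) v) <= c.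
    by apply: dual_app_le => //; apply: restr_small; rewrite ?u1.
  move: psiLBv; rewrite (kothe_restrID v mLB mA) dualD /e1; rewrite /e1 in ce1.
  by move: (Num.min e da) (psi _) (psi _) ce1 => ? ? ? ?; lra.
have [m5 m6] : Num.min e da <= e /\ Num.min e da <= da.
  by split; rewrite ge_min lexx ?orbT.
split; last by apply: le_trans psiLBAv; lra.
have [g gE g1] := dual_restr psi mLBA.
rewrite -gE; apply: (daP v g v1 (le_trans g1 psi1) _).1; first by lra.
by rewrite gE; apply: le_trans psiLBAv; lra.
Qed.

(** A set that is small for [u] in norm is small for [psi] on the almost flat [v]
    too, although [v] may have a large norm there. *)
Lemma small_set_negligible e : 0 < e ->
  exists2 c : R, 0 < c & forall (v : E) (psi : dual E) (B : set T),
    `|v| <= 1 -> `|psi| <= 1 -> measurable B -> `|kothe_restr B u| <= c ->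
    2 - c < `|u + v| -> 1 - c <= psi u \/ 1 - c <= psi v ->
    forall G, measurable G ->
      psi (kothe_restr (G `&` B) u) <= e /\ psi (kothe_restr (G `&` B) v) <= e.
Proof.
move=> e0; have [d1 d10 d1P] := su e0.
have d120 : 0 < d1 / 2 by rewrite divr_gt0.
have [d2 d20 d2P] := psi_u d120.
have [c c0 [ce [cd1 cd2]]] :
    exists2 c : R, 0 < c & c <= e /\ c <= d1 / 2 /\ c <= d2.
  exists (Num.min e (Num.min (d1 / 2) d2)); first by rewrite !lt_min e0 d120.
  by rewrite !ge_min !lexx !orbT.
exists c => // v psi B v1 psi1 mB Bc uv psiuv G mG.
have mGB : measurable (G `&` B) by exact: measurableI.
have mB' := measurableC mB.
have h1 : psi (kothe_restr (G `&` B) u) <= c.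
  by apply: dual_app_le => //; apply: le_trans Bc; exact: kothe_restr_le.
split; first exact: le_trans ce.
have h2 : psi (kothe_restr B u) <= c by exact: dual_app_le.
have psiu : 1 - d1 / 2 <= psi u.
  apply: (d2P v) => //; first by lra.
  by case: psiuv => ?; [left|right]; lra.
have psiv : 1 - e <= psi (kothe_restr (~` B) v).
  have [g gE g1] := dual_restr psi mB'.
  rewrite -gE; apply: (d1P v g v1 (le_trans g1 psi1) _).2; first by lra.
  by move: psiu; rewrite gE {1}(kothe_restrC u mB) dualD; lra.
have : psi (kothe_restr (~` B `|` G `&` B) v) <= 1.
  apply: dual_app_le => //; rewrite (le_trans _ v1)// kothe_restr_norm//.
  exact: measurableU.
rewrite kothe_restrU// ?dualD; first by lra.
by rewrite setICA setICl setI0.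
Qed.

End concentration.

(** * Order continuity of the norm *)

Section infimum_of_seminorms.
Context {R : realType} {V : lmodType R} (N : nat -> V -> R).
Hypothesis ND : forall n x y, N n (x + y) <= N n x + N n y.
Hypothesis NZ : forall n a x, N n (a *: x) = `|a| * N n x.
Hypothesis Nle : forall m n x, (m <= n)%N -> N n x <= N m x.
Hypothesis N0 : forall n x, 0 <= N n x.

Definition inf_seminorm (x : V) : R := inf (range (N ^~ x)).

Lemma inf_seminorm_le n x : inf_seminorm x <= N n x.
Proof. by apply: ge_inf; [exists 0 => _ [m _ <-]|exists n]. Qed.

Lemma le_inf_seminorm r x : (forall n, r <= N n x) -> r <= inf_seminorm x.
Proof.
by move=> rN; apply: lb_le_inf; [exists (N 0%N x), 0%N|move=> _ [n _ <-]].
Qed.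

Lemma inf_seminormD x y :
  inf_seminorm (x + y) <= inf_seminorm x + inf_seminorm y.
Proof.
rewrite -lerBlDr; apply: le_inf_seminorm => m.
rewrite lerBlDl -lerBlDr; apply: le_inf_seminorm => n.
rewrite lerBlDr addrC (le_trans (inf_seminorm_le (maxn m n) _))//.
by rewrite (le_trans (ND _ _ _))// lerD// Nle// ?leq_maxl ?leq_maxr.
Qed.

Lemma inf_seminormZ a x : inf_seminorm (a *: x) = `|a| * inf_seminorm x.
Proof.
have ge0 z : 0 <= inf_seminorm z by exact: le_inf_seminorm.
have le_ b z : inf_seminorm (b *: z) <= `|b| * inf_seminorm z.
  have [->|b0] := eqVneq b 0.
    rewrite normr0 mul0r (le_trans (inf_seminorm_le 0%N _))//.
    by rewrite NZ normr0 mul0r.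
  rewrite -ler_pdivrMl ?normr_gt0//; apply: le_inf_seminorm => n.
  by rewrite ler_pdivrMl ?normr_gt0// -NZ inf_seminorm_le.
apply/eqP; rewrite eq_le le_ /=.
have [->|a0] := eqVneq a 0; first by rewrite normr0 mul0r.
rewrite -ler_pdivlMl ?normr_gt0// -normfV.
by rewrite -{1}[x](scalerK a0) le_.
Qed.

End infimum_of_seminorms.

Section order_continuity.
Context d (T : measurableType d) (R : realType).
Context (mu : {measure set T -> \bar R}) (E : kothe_space mu).

Definition order_continuous : Prop := forall (u : E) (B : nat -> set T),
  (forall n, measurable (B n)) -> (forall m n, (m <= n)%N -> B n `<=` B m) ->
  (forall t, exists n, ~ B n t) ->
  forall e, 0 < e -> exists n, `|kothe_restr (B n) u| <= e.

Section decreasing_sets.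
Context (B : nat -> set T).
Hypothesis mB : forall n, measurable (B n).
Hypothesis Bdecr : forall m n, (m <= n)%N -> B n `<=` B m.
Hypothesis B0 : forall t, exists n, ~ B n t.

Let mBC n : measurable (~` B n).
Proof. exact: measurableC. Qed.

Let kothe_eq_restr (x y : E) :
  (forall n, kothe_restr (~` B n) x = kothe_restr (~` B n) y) -> x = y.
Proof.
move=> xy; apply: kothe_eq.
have : \forall t \ae mu, forall n,
    \1_(~` B n) t * kothe_rep x t = \1_(~` B n) t * kothe_rep y t.
  apply: ae_foralln => n; ae_use (kothe_restrE x (mBC n)).
  ae_use (kothe_restrE y (mBC n)); rewrite xy.
  by apply: aeW => t -> ->.
move=> h; ae_use h; apply: aeW => t ht; have [n Bnt] := B0 t.
by have := ht n; rewrite indicE mem_set// !mul1r.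
Qed.

Let dual_restr_fun n (h : dual E) : dual E :=
  projT1 (cid2 (dual_restr h (mB n))).

Let dual_restr_funE n h x : dual_restr_fun n h x = h (kothe_restr (B n) x).
Proof. by rewrite /dual_restr_fun; case: cid2. Qed.

(** If the norms of the restrictions of [u] stay above [e], then Hahn-Banach
    applied to their limit gives [g] whose restrictions to all the [B n] have
    norm at least [e / `|u|]; Hahn-Banach applied in the dual to the limit of
    the norms of the restricted functionals gives an element of the bidual that
    does not vanish at [g] but vanishes on all the functionals living off some
    [B n]. Such an element cannot come from a function. *)
Lemma reflexive_restr_small (u : E) e : reflexive_space E -> 0 < e ->
  exists n, `|kothe_restr (B n) u| <= e.
Proof.
move=> rE e0; apply: contrapT => /forallNP nsmall.
have big n : e <= `|kothe_restr (B n) u|.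
  by rewrite leNgt; apply/negP => /ltW; exact: nsmall.
pose N n (x : E) := `|kothe_restr (B n) x|.
have Nle m n x : (m <= n)%N -> N n x <= N m x.
  by move=> mn; apply: kothe_restr_le => //; exact: Bdecr.
have ND n x y : N n (x + y) <= N n x + N n y.
  by rewrite /N kothe_restrD// ler_normD.
have NZ n a x : N n (a *: x) = `|a| * N n x by rewrite /N kothe_restrZ// normrZ.
have N0 n x : 0 <= N n x by exact: normr_ge0.
have [g0 [g0L g0N g0u]] := hahn_banach_seminorm
  (inf_seminormD ND Nle N0) (inf_seminormZ NZ N0) u.
have [g gE g1] : exists2 g : dual E, (forall y, g y = g0 y) & `|g| <= 1.
  apply: dual_of_bounded => // y; rewrite mul1r (le_trans (g0N y))//.
  by rewrite (le_trans (inf_seminorm_le N0 0%N y))// kothe_restr_norm.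
have gu : e <= g u by rewrite gE g0u; exact: le_inf_seminorm.
have gBu n : g (kothe_restr (B n) u) = g u.
  rewrite [in RHS](kothe_restrC u (mB n)) dualD.
  suff -> : g (kothe_restr (~` B n) u) = 0 by rewrite addr0.
  apply/eqP; rewrite -normr_le0 gE (le_trans (g0N _))//.
  rewrite (le_trans (inf_seminorm_le N0 n _))// /N kothe_restrI// setICr.
  rewrite kothe_restr0.
  by rewrite normr0.
pose M n (h : dual E) := `|dual_restr_fun n h|.
have MD n h k : M n (h + k) <= M n h + M n k.
  rewrite /M; suff -> : dual_restr_fun n (h + k) =
    dual_restr_fun n h + dual_restr_fun n k by exact: ler_normD.
  apply/val_inj/funext => x.
  change (dual_restr_fun n (h + k) x =
    dual_restr_fun n h x + dual_restr_fun n k x).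
  by rewrite !dual_restr_funE.
have MZ n a h : M n (a *: h) = `|a| * M n h.
  rewrite /M; suff -> : dual_restr_fun n (a *: h) = a *: dual_restr_fun n h.
    exact: normrZ.
  apply/val_inj/funext => x.
  change (dual_restr_fun n (a *: h) x = a * dual_restr_fun n h x).
  by rewrite !dual_restr_funE.
have M0 n h : 0 <= M n h by exact: normr_ge0.
have Mle m n h : (m <= n)%N -> M n h <= M m h.
  move=> mn; apply: dual_norm_le => x x1.
  have -> : dual_restr_fun n h x = dual_restr_fun m h (kothe_restr (B n) x).
    rewrite !dual_restr_funE kothe_restrI//.
    by rewrite (_ : B m `&` B n = B n)//; apply/setIidr; exact: Bdecr.
  rewrite (le_trans (dual_norm_app _ _))// ler_piMr//.
  by rewrite (le_trans (kothe_restr_norm _ _)).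
have [F0 [F0L F0M F0g]] := hahn_banach_seminorm
  (inf_seminormD MD Mle M0) (inf_seminormZ MZ M0) g.
have [F FE F1] : exists2 F : dual (dual E), (forall h, F h = F0 h) & `|F| <= 1.
  apply: dual_of_bounded => // h; rewrite mul1r (le_trans (F0M h))//.
  rewrite (le_trans (inf_seminorm_le M0 0%N h))//.
  by rewrite /M /dual_restr_fun; case: cid2.
have [x xF] := rE F.
have x0 : x = 0.
  apply: kothe_eq_restr => n.
  apply/eqP; rewrite -subr_eq0 -normr_le0.
  have [h h1 <-] := norming_functional
    (kothe_restr (~` B n) x - kothe_restr (~` B n) 0).
  have [k kE _] := dual_restr h (mBC n).
  rewrite dualB -!kE dual0 subr0 -xF FE (le_trans (ler_norm _))//.
  rewrite (le_trans (F0M _))// (le_trans (inf_seminorm_le M0 n _))//.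
  apply: dual_norm_le => y y1; rewrite dual_restr_funE kE kothe_restrI//.
  rewrite setICl.
  rewrite kothe_restr0.
  by rewrite dual0 normr0.
have : F g = 0 by rewrite xF x0 dual0.
rewrite FE F0g; apply/eqP; rewrite gt_eqF//.
have u0 : 0 < `|u|.
  rewrite (lt_le_trans e0)// (le_trans gu)//.
  exact: dual_app_le.
apply: (@lt_le_trans _ _ (e / `|u|)); first exact: divr_gt0.
apply: le_inf_seminorm => n; rewrite ler_pdivrMr// (le_trans gu)//.
rewrite -(gBu n) -dual_restr_funE (le_trans (ler_norm _))//.
exact: dual_norm_app.
Qed.

(** If the truncations of [u] to the complements of the [B n] converge, the limit
    is [u]. Otherwise [u] has infinitely many disjoint blocks of norm at least
    some [e'], and a weak* limit of functionals norming these blocks would have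
    to distinguish the even from the odd ones. *)
Lemma weak_star_seq_compact_restr_small (u : E) e :
  weak_star_seq_compact (closed_unit_ball (dual E)) -> 0 < e ->
  exists n, `|kothe_restr (B n) u| <= e.
Proof.
move=> wE e0.
have mD m n : measurable (B m `&` ~` B n) by exact: measurableI.
have trunc m n : (m <= n)%N -> kothe_restr (~` B n) u =
    kothe_restr (~` B m) u + kothe_restr (B m `&` ~` B n) u.
  move=> mn; rewrite -kothe_restrU//; last by rewrite setIA setICl set0I.
  congr kothe_restr; apply/seteqP; split => t /=.
    by move=> Bnt; have [Bmt|] := pselect (B m t); [right|left].
  by move=> [Bmt|[]//] /(Bdecr mn).
have [cauchy_u|ncauchy] := pselect (forall e', 0 < e' -> exists m,
    forall n, (m <= n)%N -> `|kothe_restr (B m `&` ~` B n) u| < e').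
  pose u_ n := kothe_restr (~` B n) u.
  have cu : cvg (u_ @ \oo).
    apply/cauchy_cvgP/cauchy_exP => e' e'0.
    have [m mP] := cauchy_u _ e'0; exists (u_ m).
    exists m => // n /= mn; rewrite -ball_normE /= distrC /u_ (trunc _ _ mn).
    by rewrite addrAC subrr add0r; exact: mP.
  have lu : lim (u_ @ \oo) = u.
    apply: kothe_eq_restr => m; apply/eqP; rewrite -subr_eq0 -normr_le0.
    apply/ler_addgt0Pl => e' e'0; rewrite addr0.
    move/cvgrPdist_le : cu => /(_ _ e'0) [n _ nP].
    have := nP (maxn m n) (leq_maxr _ _).
    apply: le_trans.
    have -> : kothe_restr (~` B m) u =
        kothe_restr (~` B m) (u_ (maxn m n)).
      rewrite /u_ kothe_restrI//; congr kothe_restr; apply/esym/setIidl.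
      by apply: subsetC; apply: Bdecr; exact: leq_maxl.
    have -> : kothe_restr (~` B m) (lim (u_ @ \oo)) -
        kothe_restr (~` B m) (u_ (maxn m n)) =
        kothe_restr (~` B m) (lim (u_ @ \oo) - u_ (maxn m n)).
      rewrite -scaleN1r addrC -kothe_restr_linear// scaleN1r.
      by rewrite addrC.
    exact: kothe_restr_norm.
  move/cvgrPdist_le : cu => /(_ _ e0) [n _ nP]; exists n.
  have := nP n (leqnn n); rewrite lu /u_ {1}(kothe_restrC u (mB n)).
  by rewrite addrK.
exfalso.
have [e' [e'0 e'P]] : exists e' : R, 0 < e' /\ forall m, exists n,
    (m < n)%N /\ e' <= `|kothe_restr (B m `&` ~` B n) u|.
  apply: contrapT => /forallNP ne; apply: ncauchy => e' e'0.
  apply: contrapT => /forallNP nm; apply: (ne e'); split => // m.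
  have /existsNP[n /not_implyP[mn /negP]] := nm m.
  rewrite -leNgt => h; exists n.+1; split; first by rewrite ltnS.
  apply: le_trans h _; apply: kothe_restr_le => //.
  by apply: setIS; apply: subsetC; exact: Bdecr.
have [next nextP] := choice e'P.
pose k := fix k j := if j is i.+1 then next (k i) else 0%N.
have kS j : (k j < k j.+1)%N by have [] := nextP (k j).
have kmono i j : (i <= j)%N -> (k i <= k j)%N.
  move=> /subnK <-; elim: (j - i)%N => // l.
  by move/leq_trans; apply; exact: ltnW.
pose C j := B (k j) `&` ~` B (k j.+1).
have mC j : measurable (C j) by exact: mD.
have Cu j : e' <= `|kothe_restr (C j) u| by have [] := nextP (k j).
have Cdisj i j t : C i t -> C j t -> i = j.
  have le_ i' j' : (i' < j')%N -> C i' t -> C j' t -> False.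
    move=> ij [_ Bi] [Bj _]; apply: Bi; apply: Bdecr Bj.
    exact: kmono.
  move=> Ci Cj; have [ij|ij|//] := ltngtP i j.
    by case: (le_ _ _ ij Ci Cj).
  by case: (le_ _ _ ij Cj Ci).
have hP j : exists h : dual E, `|h| <= 1 /\
    exists2 g : dual E, (forall s, h s = g (kothe_restr (C j) s)) &
      g (kothe_restr (C j) u) = `|kothe_restr (C j) u|.
  have [g g1 gu] := norming_functional (kothe_restr (C j) u).
  have [h hE hg] := dual_restr g (mC j).
  by exists h; split; [exact: le_trans g1|exists g].
have [h {}hP] := choice hP.
have [l [f [lmono _ hf]]] := wE h (fun n => (hP n).1).
have linj i j : l i = l j -> i = j.
  move=> lij; have [ij|ij|//] := ltngtP i j.
    by have := lmono _ _ ij; rewrite lij ltnn.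
  by have := lmono _ _ ij; rewrite lij ltnn.
pose D := \bigcup_i C (l i.*2).
have mDD : measurable D by apply: bigcup_measurable.
have := hf (kothe_restr D u).
have heven i : e' <= h (l i.*2) (kothe_restr D u).
  have [_ [g gE gu]] := hP (l i.*2); rewrite gE kothe_restrI//.
  rewrite (_ : C _ `&` D = C (l i.*2)) ?gu//.
  by apply/setIidl => t Ct; exists i.
have hodd i : h (l i.*2.+1) (kothe_restr D u) = 0.
  have [_ [g gE _]] := hP (l i.*2.+1); rewrite gE kothe_restrI//.
  rewrite (_ : C _ `&` D = set0).
    rewrite kothe_restr0.
    exact: dual0.
  apply/seteqP; split => // t [Ct [j _ Cj]].
  have /linj/(congr1 odd) := Cdisj _ _ _ Ct Cj.
  by rewrite /= !odd_double.
move=> /cvgrPdist_lt/(_ (e' / 2)); rewrite divr_gt0// => /(_ isT) [n _ nP].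
have n2 : (n <= n.*2)%N by rewrite -addnn leq_addr.
have := nP n.*2 n2; have := nP n.*2.+1 (leqW n2); rewrite /= hodd subr0.
have := heven n; rewrite !ltr_norml => ? /andP[_ ?] /andP[? ?]; lra.
Qed.

End decreasing_sets.

Lemma reflexive_order_continuous : reflexive_space E -> order_continuous.
Proof. by move=> rE u B mB Bd B0 e e0; exact: reflexive_restr_small. Qed.

Lemma weak_star_seq_compact_order_continuous :
  weak_star_seq_compact (closed_unit_ball (dual E)) -> order_continuous.
Proof.
by move=> wE u B mB Bd B0 e e0; exact: weak_star_seq_compact_restr_small.
Qed.

End order_continuity.

(** * Bochner measurable functions *)

Section bochner_measurable_theory.
Import HBSimple.
Context d (T : measurableType d) (R : realType).
Context (mu : {measure set T -> \bar R}) (X : normedModType R).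

Lemma complete_measurable_ae_eq (A B : set T) : measure_is_complete mu ->
  measurable A -> (\forall t \ae mu, A t <-> B t) -> measurable B.
Proof.
move=> cmu mA [N [mN N0 ABN]].
have -> : B = (A `&` ~` N) `|` (B `&` N).
  apply/seteqP; split => t.
    move=> Bt; have [Nt|Nt] := pselect (N t); [by right|left; split => //].
    by apply: contrapT => At; apply: Nt; apply: ABN => /= -[_ /(_ Bt)].
  case=> [[At Nt]|[]//]; apply: contrapT => Bt; apply: Nt; apply: ABN => /=.
  by move=> [/(_ At)].
apply: measurableU; first by apply: measurableI => //; exact: measurableC.
by apply: cmu; exists N; split => // t [].
Qed.

(** A limit lies in a closed set exactly when the sequence eventually enters
    each neighborhood of that set; the preimages of arbitrary sets by simple
    functions are measurable. *)
Lemma bochner_closed_preimage (f : T -> X) (Q : set X) :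
  measure_is_complete mu -> bochner_measurable mu f -> closed Q ->
  measurable (f @^-1` Q).
Proof.
move=> cmu [s [ss sf]] cQ.
pose Q_ k : set X := [set z | exists2 q, Q q & `|z - q| < k.+1%:R^-1].
pose A := \bigcap_k \bigcup_N \bigcap_(n in [set n | (N <= n)%N])
  (s n @^-1` (Q_ k)).
have mA : measurable A.
  apply: bigcap_measurableType => k _; apply: bigcup_measurable => N _.
  by apply: bigcap_measurableType => n _; exact: simple_fun_preimage.
apply: (complete_measurable_ae_eq cmu mA); ae_use sf; apply: aeW => t st.
split=> [At|Qft k _].
- apply: cQ => U /nbhs_ballP[e /= e0 eU].
  have e20 : 0 < e / 2 by rewrite divr_gt0.
  have [k _ kP] := near_infty_natSinv_lt (PosNum e20).
  have [N _ NP] := At k I.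
  move/cvgrPdist_lt : st => /(_ _ e20) [M _ MP].
  have [q Qq qs] := NP (maxn N M) (leq_maxl _ _).
  exists q; split => //; apply: eU; rewrite -ball_normE /=.
  have := MP (maxn N M) (leq_maxr _ _); have := kP k (leqnn k) => /= h1 h2.
  have -> : f t - q = (f t - s (maxn N M) t) + (s (maxn N M) t - q).
    by rewrite addrA subrK.
  rewrite (le_lt_trans (ler_normD _ _))// (splitr e) ltrD//.
  exact: lt_trans h1.
- have k0 : (0 : R) < k.+1%:R^-1 by rewrite invr_gt0.
  move/cvgrPdist_lt : st => /(_ _ k0) [N _ NP]; exists N => // n /= Nn.
  by exists (f t) => //; rewrite distrC; exact: NP.
Qed.

Lemma bochner_measurable_scale (a : T -> R) (f : T -> X) :
  measurable_fun setT a -> bochner_measurable mu f ->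
  bochner_measurable mu (fun t => a t *: f t).
Proof.
move=> ma [s [ss sf]].
have mEa : measurable_fun setT (EFin \o a) by exact/measurable_EFinP.
have [g gE] := approximation_sfun measurableT mEa.
exists (fun n t => g n t *: s n t); split.
- move=> n; have [fs _] := ss n; split.
    have : finite_set
        ((fun p : R * X => p.1 *: p.2) @` (range (g n) `*` range (s n))).
      by apply: finite_image; apply: finite_setX => //; exact: fimfunP.
    by apply: sub_finite_set => _ [t _ <-]; exists (g n t, s n t).
  move=> x; rewrite (_ : _ @^-1` [set x] = \bigcup_(r in range (g n))
      (g n @^-1` [set r] `&` s n @^-1` [set z | r *: z = x])).
    apply: fin_bigcup_measurable => [|r _]; first exact: fimfunP.
    apply: measurableI; first exact: measurable_sfunP.
    exact: simple_fun_preimage.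
  apply/seteqP; split => t /=.
    by move=> <-; exists (g n t); [exists t|].
  by move=> [_ [t' _ <-]] [/= -> ->].
- ae_use sf; apply: aeW => t st; apply: cvgZ => //.
  by have /fine_cvgP[_] := gE t I.
Qed.

End bochner_measurable_theory.

(** * Calculus in the Kothe-Bochner space *)

Section kothe_bochner_calculus.
Local Open Scope quotient_scope.
Context d (T : measurableType d) (R : realType).
Context (mu : {measure set T -> \bar R}) (E : kothe_space mu).
Context (X : normedModType R).
Implicit Types F H : kothe_bochner E X.

Definition kb_rep F : T -> X := (repr F : kb_fun E X).

Definition kb_abs F : E := kb_normfun (repr F).

Lemma kb_absE F : \forall t \ae mu, kothe_rep (kb_abs F) t = `|kb_rep F t|.
Proof. by ae_use (kb_normfunP (repr F)); apply: aeW => t; apply. Qed.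

Lemma norm_kb_abs F : `|kb_abs F| = `|F|.
Proof. by []. Qed.

Lemma kb_rep_bochner F : bochner_measurable mu (kb_rep F).
Proof. exact: kb_bochner_measurable. Qed.

Lemma kb_rep_linear (a : R) F H : \forall t \ae mu,
  kb_rep (a *: F + H) t = a *: kb_rep F t + kb_rep H t.
Proof.
have -> : a *: F + H = \pi_(kothe_bochner E X) (a *: repr F + repr H).
  rewrite pi_kbD -pi_kb_scale !reprK; congr (_ + _).
ae_use (kb_reprP (a *: repr F + repr H)).
by apply: aeW => t /(_ I).
Qed.

Lemma kb_repD F H : \forall t \ae mu,
  kb_rep (F + H) t = kb_rep F t + kb_rep H t.
Proof.
ae_use (kb_rep_linear 1 F H).
by apply: aeW => t; rewrite !scale1r.
Qed.

Lemma kb_rep0 : \forall t \ae mu, kb_rep (0 : kothe_bochner E X) t = 0.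
Proof. 
ae_use (@kb_reprP _ _ _ _ E X 0).
by apply: aeW => t /(_ I); rewrite pi_kb0.
Qed.

Lemma kb_repZ (a : R) F : \forall t \ae mu,
  kb_rep (a *: F) t = a *: kb_rep F t.
Proof.
ae_use (kb_rep_linear a F 0); ae_use kb_rep0.
by apply: aeW => t -> ; rewrite !addr0.
Qed.

Lemma kb_repB F H : \forall t \ae mu,
  kb_rep (F - H) t = kb_rep F t - kb_rep H t.
Proof.
ae_use (kb_rep_linear (-1) H F).
by apply: aeW => t; rewrite !scaleN1r ![- _ + _]addrC.
Qed.

Lemma kb_rep_inj F H : (\forall t \ae mu, kb_rep F t = kb_rep H t) -> F = H.
Proof.
move=> FH; rewrite -(reprK F) -(reprK H); apply/kb_eqP.
by ae_use FH; apply: aeW => t + _.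
Qed.

Lemma kb_norm_le F (r : E) :
  (\forall t \ae mu, `|kb_rep F t| <= `|kothe_rep r t|) -> `|F| <= `|r|.
Proof.
move=> Fr; rewrite -norm_kb_abs; apply: kothe_le.
by ae_use Fr; ae_use (kb_absE F); apply: aeW => t ->; rewrite normr_id.
Qed.

Lemma kb_of_bounded (h : T -> X) (r : E) : bochner_measurable mu h ->
  (\forall t \ae mu, `|h t| <= `|kothe_rep r t|) ->
  exists F, \forall t \ae mu, kb_rep F t = h t.
Proof.
move=> mh hr; have [n mn nE] := bochner_measurable_norm mh.
have nr : \forall t \ae mu, `|n t| <= `|kothe_rep r t|.
  by ae_use hr; ae_use nE; apply: aeW => t /(_ I) ->; rewrite normr_id.
have [v vE] := kothe_le_of_measurable mn nr.
have hP : h \in @kb_pred _ _ _ _ E X.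
  apply/asboolP; split => //; exists v; ae_use vE; ae_use nE.
  by apply: aeW => t /(_ I) -> -> _.
exists (\pi_(kothe_bochner E X) (KbFun hP)).
by ae_use (kb_reprP (KbFun hP)); apply: aeW => t /(_ I).
Qed.

Lemma kb_restr_ex (G : set T) F : exists H, measurable G ->
  \forall t \ae mu, kb_rep H t = \1_G t *: kb_rep F t.
Proof.
have [mG|] := pselect (measurable G); last by exists 0.
have [||H HE] := @kb_of_bounded (fun t => \1_G t *: kb_rep F t) (kb_abs F).
- by apply: bochner_measurable_scale => //; exact: kb_rep_bochner.
- ae_use (kb_absE F); apply: aeW => t ->; rewrite normr_id indicE normrZ.
  by case: (t \in G); rewrite ?normr1 ?mul1r// normr0 mul0r.
by exists H.
Qed.

Definition kb_restr (G : set T) F := projT1 (cid (kb_restr_ex G F)).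

Lemma kb_restrE (G : set T) F : measurable G ->
  \forall t \ae mu, kb_rep (kb_restr G F) t = \1_G t *: kb_rep F t.
Proof. exact: projT2 (cid (kb_restr_ex G F)). Qed.

(** A functional [phi] on the Kothe-Bochner space and a field [e] of vectors in
    the unit ball induce the functional [s |-> phi (s e)] on the scalar space. *)
Lemma scalar_functional (phi : dual (kothe_bochner E X)) (e : T -> X) :
  `|phi| <= 1 -> bochner_measurable mu e -> (\forall t \ae mu, `|e t| <= 1) ->
  exists (psi : dual E) (J : E -> kothe_bochner E X), [/\ `|psi| <= 1,
    forall s, \forall t \ae mu, kb_rep (J s) t = kothe_rep s t *: e t &
    forall s F, (\forall t \ae mu, kb_rep F t = kothe_rep s t *: e t) ->
      phi F = psi s].
Proof.
move=> phi1 me e1.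
have se (s : E) : \forall t \ae mu, `|kothe_rep s t *: e t| <= `|kothe_rep s t|.
  by ae_use e1; apply: aeW => t et; rewrite normrZ ler_piMr.
have /choice[J JE] : forall s : E, exists F : kothe_bochner E X,
    \forall t \ae mu, kb_rep F t = kothe_rep s t *: e t.
  move=> s; have [|F FE] := kb_of_bounded _ (se s); last by exists F.
  by apply: bochner_measurable_scale => //; exact: kothe_measurable.
have J1 (s : E) : `|J s| <= `|s|.
  by apply: kb_norm_le; ae_use (JE s); ae_use (se s); apply: aeW => t + ->.
have [psi psiE psi1] : exists2 psi : dual E, (forall s, psi s = phi (J s)) &
    `|psi| <= 1.
  apply: dual_of_bounded => // [a s r|s]; last first.
    rewrite mul1r (le_trans (dual_norm_app _ _))// (le_trans _ (J1 s))//.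
    by rewrite ler_piMl.
  rewrite -dual_linear; congr (phi _); apply: kb_rep_inj.
  ae_use (JE (a *: s + r)); ae_use (JE s); ae_use (JE r).
  ae_use (kb_rep_linear a (J s) (J r)); ae_use (kothe_linearE a s r).
  by apply: aeW => t -> -> -> -> ->; rewrite scalerDl scalerA.
exists psi, J; split => // s F FE; rewrite psiE; congr (phi _).
apply: kb_rep_inj; ae_use FE; ae_use (JE s).
by apply: aeW => t -> ->.
Qed.

(** If [phi] is almost 1 on [A], with [A] and [B] both bounded by [r], and if
    [A - tau *: B] is as short as pointwise sluacs+ makes it, then [phi] is
    almost 1 on [B]. The shortening is only needed on the part [G `\` D] of a
    set [G] carrying almost all of [phi] on [A]; the accuracy [tau * ep] is
    needed for [G], since the shortening is of order [tau], but only [ep] for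
    [D], where [(1 - tau * (1 - ep)) *: A] replaces [A - tau *: B]. *)
Lemma shortened_functional_le (phi : dual (kothe_bochner E X))
    (A B : kothe_bochner E X) (r : E) (G D : set T) (tau ep : R) :
  `|phi| <= 1 -> `|r| <= 1 -> measurable G -> measurable D ->
  0 < tau -> tau <= 1 -> 0 <= ep -> ep <= 1 ->
  (\forall t \ae mu, `|kb_rep A t| <= kothe_rep r t) ->
  (\forall t \ae mu, `|kb_rep B t| <= kothe_rep r t) ->
  (\forall t \ae mu, G t -> ~ D t ->
    `|kb_rep A t - tau *: kb_rep B t| <= (1 - tau * (1 - ep)) * kothe_rep r t) ->
  1 - tau * ep <= phi (kb_restr G A) ->
  phi (kb_restr (G `&` D) A) <= ep ->
  1 - 5 * ep <= phi B.
Proof.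
move=> phi1 r1 mG mD tau0 tau1 ep0 ep1 Ar Br ABr phiG phiGD.
have mD' := measurableC mD.
have mGD : measurable (G `&` D) by exact: measurableI.
have mGD' : measurable (G `&` ~` D) by exact: measurableI.
have lam0 : 0 <= 1 - tau * (1 - ep) by nra.
have phiGDD : phi (kb_restr G A) =
    phi (kb_restr (G `&` D) A) + phi (kb_restr (G `&` ~` D) A).
  rewrite -dualD; congr (phi _); apply: kb_rep_inj.
  ae_use (kb_repD (kb_restr (G `&` D) A) (kb_restr (G `&` ~` D) A)).
  ae_use (kb_restrE A mG); ae_use (kb_restrE A mGD).
  ae_use (kb_restrE A mGD'); apply: aeW => t -> -> -> ->.
  rewrite -scalerDl; congr (_ *: _); rewrite !indicE !in_setI in_setC.
  by case: (t \in G) => /=; case: (t \in D); rewrite /= ?addr0 ?add0r.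
have short : phi (kb_restr G A - (tau *: kb_restr (G `&` ~` D) B +
    (tau * (1 - ep)) *: kb_restr (G `&` D) A)) <= 1 - tau * (1 - ep).
  apply: dual_app_le => //.
  apply: (@le_trans _ _ `|(1 - tau * (1 - ep)) *: r|); last first.
    by rewrite normrZ ger0_norm// ler_piMr.
  apply: kb_norm_le.
  ae_use (kb_repB (kb_restr G A) (tau *: kb_restr (G `&` ~` D) B +
    (tau * (1 - ep)) *: kb_restr (G `&` D) A)).
  ae_use (kb_rep_linear tau (kb_restr (G `&` ~` D) B)
    ((tau * (1 - ep)) *: kb_restr (G `&` D) A)).
  ae_use (kb_repZ (tau * (1 - ep)) (kb_restr (G `&` D) A)).
  ae_use (kb_restrE A mG); ae_use (kb_restrE A mGD).
  ae_use (kb_restrE B mGD'); ae_use (kothe_scaleE (1 - tau * (1 - ep)) r).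
  ae_use Ar; ae_use ABr.
  apply: aeW => t ABrt Art -> -> -> -> -> -> ->.
  have rt0 : 0 <= kothe_rep r t by rewrite (le_trans _ Art).
  rewrite [leRHS]ger0_norm ?mulr_ge0// !indicE !in_setI in_setC.
  have [Gt|Gt] := boolP (t \in G); last first.
    by rewrite /= !scale0r !scaler0 addr0 subr0 normr0 mulr_ge0.
  have [Dt|Dt] := boolP (t \in D) => /=.
    rewrite scale0r scaler0 add0r !scale1r -[X in X - _]scale1r -scalerBl.
    by rewrite normrZ ger0_norm// ler_wpM2l.
  rewrite scale0r scaler0 addr0 !scale1r; apply: ABrt; first exact: set_mem.
  by move=> /mem_set Dt'; rewrite Dt' in Dt.
have rest : phi (kb_restr (G `&` ~` D) A - (B - kb_restr (G `&` ~` D) B)) <= 1.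
  apply: dual_app_le => //; apply: le_trans r1; apply: kb_norm_le.
  ae_use (kb_repB (kb_restr (G `&` ~` D) A) (B - kb_restr (G `&` ~` D) B)).
  ae_use (kb_repB B (kb_restr (G `&` ~` D) B)).
  ae_use (kb_restrE A mGD'); ae_use (kb_restrE B mGD').
  ae_use Ar; ae_use Br.
  apply: aeW => t Brt Art -> -> -> ->.
  have rt0 : 0 <= kothe_rep r t by rewrite (le_trans _ Art).
  rewrite [leRHS]ger0_norm// indicE.
  case: (t \in _) => /=; first by rewrite !scale1r subrr subr0.
  by rewrite !scale0r subr0 sub0r normrN.
move: short rest; rewrite !dualB dualD !dualZ => short rest.
set pG := phi (kb_restr G A) in phiG phiGDD short.
set pGD := phi (kb_restr (G `&` D) A) in phiGD phiGDD short.
set pGDB := phi (kb_restr (G `&` ~` D) B) in short rest.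
set pGDA := phi (kb_restr (G `&` ~` D) A) in phiGDD rest.
have pGD' : (tau * (1 - ep)) * pGD <= tau * ep.
  rewrite (@le_trans _ _ ((tau * (1 - ep)) * ep))//.
    by rewrite ler_wpM2l// mulr_ge0 ?subr_ge0// ltW.
  by rewrite -mulrA ler_wpM2l ?(ltW tau0)// ler_piMl// gerBl.
have : tau * (1 - 3 * ep) <= tau * pGDB by lra.
rewrite ler_pM2l// => h.
have : tau * ep <= ep by rewrite ler_piMl.
lra.
Qed.

End kothe_bochner_calculus.

(** * Pointwise shortening *)

Section shortening.
Context {R : realType} (X : normedModType R).

(** The vectors in whose direction [dl] is admissible in [sluacs_shortening] for
    the accuracy [ep]. The form is homogeneous, as normalizing [z] would not be
    continuous at 0 and the set has to be closed. *)
Definition shortening_set (ep dl : R) : set X := [set z |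
  forall tau e, 0 < tau <= dl -> `|e| <= 1 ->
  (2 - tau) * `|z| < `|z + `|z| *: e| ->
  `| `|z| *: e - tau *: z| <= (1 - tau * (1 - ep)) * `|z| /\
  `|z - tau *: (`|z| *: e)| <= (1 - tau * (1 - ep)) * `|z| ].

Let closed_le_fun (f g : X -> R) : continuous f -> continuous g ->
  closed [set z | f z <= g z].
Proof.
move=> cf cg; rewrite (_ : [set _ | _] = (g \- f) @^-1` [set x | 0 <= x]).
  apply: preimage_closed (@closed_ge _ 0) => z _.
  by apply: cvgB; [exact: cg|exact: cf].
by apply/seteqP; split => z /=; rewrite subr_ge0.
Qed.

Lemma closed_shortening_set ep dl : closed (shortening_set ep dl).
Proof.
have cn : continuous (fun z : X => `|z|) by exact: norm_continuous.
have cM (a : R) : continuous (fun z : X => a * `|z|).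
  by move=> z; apply: cvgMr; exact: cn.
have cZ (e : X) : continuous (fun z : X => `|z| *: e).
  by move=> z; apply: cvgZr_tmp; exact: cn.
rewrite (_ : shortening_set ep dl = \bigcap_(te in
    [set te : R * X | 0 < te.1 <= dl /\ `|te.2| <= 1])
  ([set z | `|z + `|z| *: te.2| <= (2 - te.1) * `|z|] `|`
   ([set z | `| `|z| *: te.2 - te.1 *: z| <= (1 - te.1 * (1 - ep)) * `|z|] `&`
    [set z | `|z - te.1 *: (`|z| *: te.2)| <= (1 - te.1 * (1 - ep)) * `|z|]))).
  apply: closed_bigI => -[t e] _ /=; apply: closedU; last apply: closedI.
  - apply: closed_le_fun => // z; apply: cvg_norm; apply: cvgD => //.
    exact: cZ.
  - apply: closed_le_fun => // z; apply: cvg_norm; apply: cvgB; first exact: cZ.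
    exact: cvgZl_tmp.
  - apply: closed_le_fun => // z; apply: cvg_norm; apply: cvgB => //.
    by apply: cvgZl_tmp; exact: cZ.
apply/seteqP; split => [z zS [t e] [/= t0 e1]|z zS t e t0 e1 lt].
  have [|lt] := leP `|z + `|z| *: e| ((2 - t) * `|z|); first by left.
  by right; exact: zS.
have [/=|//] := zS (t, e) (conj t0 e1).
by rewrite leNgt lt.
Qed.

Lemma shortening_set_anti ep dl dl' : dl' <= dl ->
  shortening_set ep dl `<=` shortening_set ep dl'.
Proof.
move=> dd z zS t e /andP[t0 td]; apply: zS.
by rewrite t0 (le_trans td).
Qed.

Lemma shortening_set_cover ep z : sluacs_plus X -> 0 < ep ->
  exists2 dl, 0 < dl & shortening_set ep dl z.
Proof.
move=> sX ep0; have [->|z0] := eqVneq z 0.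
  by exists 1 => // t e _ _; rewrite normr0 mulr0 scale0r addr0 normr0 ltxx.
have nz : 0 < `|z| by rewrite normr_gt0.
have [x x1 zx] : exists2 x : X, `|x| = 1 & z = `|z| *: x.
  exists (`|z|^-1 *: z); first by rewrite normrZ normfV normr_id mulVf ?gt_eqF.
  by rewrite scalerA divff ?gt_eqF// scale1r.
have [dl dl0 dlP] := sluacs_shortening sX x1 ep0.
exists dl => // t e /andP[t0 td] e1.
move: (`|z|) nz zx => r r0 ->.
have nr y : `|r *: y| = r * `|y| by rewrite normrZ gtr0_norm.
rewrite -scalerDr nr mulrC ltr_pM2l// => xe.
have [h1 h2] := dlP t t0 td e e1 xe.
split.
  by rewrite scalerA mulrC -scalerA -scalerBr nr mulrC ler_wpM2r// ltW.
by rewrite scalerA mulrC -scalerA -scalerBr nr mulrC ler_wpM2r// ltW.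
Qed.

(** When the lengths of [z] and [y] are comparable, [`|z + y|] being almost
    [`|z| + `|y|] forces the normalized vectors to be almost flat too. *)
Lemma comparable_shortening (z y : X) c eta tau ep dl :
  0 < c -> 0 < eta -> eta * (1 + c^-1) < tau -> tau <= dl ->
  (1 - eta) * (`|z| + `|y|) <= `|z + y| ->
  c * `|z| < `|y| -> c * `|y| < `|z| -> shortening_set ep dl z ->
  `| `|z| *: (`|y|^-1 *: y) - tau *: z| <= (1 - tau * (1 - ep)) * `|z| /\
  `| `|y| *: (`|z|^-1 *: z) - tau *: y| <= (1 - tau * (1 - ep)) * `|y|.
Proof.
move=> c0 eta0 etac taudl zy czy cyz zS.
have y0 : 0 < `|y| by rewrite (le_lt_trans _ czy)// mulr_ge0// ltW.
have z0 : 0 < `|z| by rewrite (le_lt_trans _ cyz)// mulr_ge0// ltW.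
have ci0 : 0 < c^-1 by rewrite invr_gt0.
have tau0 : 0 < tau by rewrite (le_lt_trans _ etac)// mulr_ge0 ?ltW// ltr_wpDl.
have [e -> [e1 ye]] : exists2 e, `|y|^-1 *: y = e & `|e| = 1 /\ y = `|y| *: e.
  exists (`|y|^-1 *: y) => //; split.
    by rewrite normrZ normfV normr_id mulVf ?gt_eqF.
  by rewrite scalerA divff ?gt_eqF// scale1r.
have small a b : 0 < a -> c * b < a -> eta * (a + b) < tau * a.
  move=> a0 cba; apply: (@le_lt_trans _ _ (eta * (1 + c^-1) * a)).
    rewrite -mulrA ler_pM2l// mulrDl mul1r lerD2l.
    by rewrite ler_pdivlMl// ltW.
  by rewrite ltr_pM2r.
have flat : (2 - tau) * `|z| < `|z + `|z| *: e|.
  have [le_zy|lt_yz] := leP `|z| `|y|.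
    have : `|z + y| <= `|z + `|z| *: e| + (`|y| - `|z|).
      have -> : z + y = (z + `|z| *: e) + (`|y| - `|z|) *: e.
        by rewrite scalerBl -ye -addrA; congr (_ + _); rewrite addrC subrK.
      rewrite (le_trans (ler_normD _ _))// [X in _ + X]normrZ e1 mulr1.
      by rewrite ger0_norm// subr_ge0.
    have := small _ _ z0 cyz.
    move: zy; move: (`|z + y|) (`|z + `|z| *: e|) => p q; nra.
  have : `|z| * `|z + y| <= `|y| * `|z + `|z| *: e| + (`|z| - `|y|) * `|z|.
    have -> : `|z| * `|z + y| = `| `|y| *: (z + `|z| *: e) +
        (`|z| - `|y|) *: z|.
      have -> : `|y| *: (z + `|z| *: e) + (`|z| - `|y|) *: z =
          `|z| *: (z + y).
        rewrite !scalerDr scalerBl scalerA mulrC -scalerA -ye.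
        by rewrite addrC addrA subrK.
      by rewrite normrZ normr_id.
    rewrite (le_trans (ler_normD _ _))// !normrZ !normr_id.
    by rewrite (@ger0_norm _ (`|z| - `|y|))// subr_ge0 ltW.
  have := small _ _ y0 czy.
  move: zy; move: (`|z + y|) (`|z + `|z| *: e|) => p q zy h1 h2.
  rewrite -(ltr_pM2l y0).
  have h3 : `|z| * ((1 - eta) * (`|z| + `|y|)) <= `|z| * p by rewrite ler_pM2l.
  have h4 : `|z| * (eta * (`|y| + `|z|)) < `|z| * (tau * `|y|).
    by rewrite ltr_pM2l.
  lra.
have td : 0 < tau <= dl by rewrite tau0.
have e1' : `|e| <= 1 by rewrite e1.
have [h1 h2] := zS tau e td e1' flat; split => //.
have -> : `|y| *: (`|z|^-1 *: z) - tau *: y =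
    (`|y| / `|z|) *: (z - tau *: (`|z| *: e)).
  rewrite scalerBr scalerA; congr (_ - _).
  rewrite [in LHS]ye !scalerA; congr (_ *: _).
  by field; rewrite gt_eqF.
rewrite normrZ ger0_norm ?divr_ge0//.
rewrite (le_trans (ler_wpM2l _ h2)) ?divr_ge0//.
by rewrite mulrCA -(mulrA `|y|) mulVf ?gt_eqF// mulr1.
Qed.

End shortening.

(** * Transfer of sluacs+ to the Kothe-Bochner space *)

Section transfer.
Context d (T : measurableType d) (R : realType).
Context (mu : {measure set T -> \bar R}) (E : kothe_space mu).
Context (X : normedModType R).

Lemma kb_direction (F : kothe_bochner E X) : exists e : T -> X,
  [/\ bochner_measurable mu e, \forall t \ae mu, `|e t| <= 1,
    \forall t \ae mu, kb_rep F t = kothe_rep (kb_abs F) t *: e t &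
    \forall t \ae mu, e t = `|kb_rep F t|^-1 *: kb_rep F t].
Proof.
pose e t := (kothe_rep (kb_abs F) t) `^ (-1) *: kb_rep F t.
have eE : \forall t \ae mu, e t = `|kb_rep F t|^-1 *: kb_rep F t.
  by ae_use (kb_absE F); apply: aeW => t tE; rewrite /e tE powR_inv1.
exists e; split => //.
- apply: bochner_measurable_scale; last exact: kb_rep_bochner.
  exact: (measurableT_comp (@measurable_powR R (-1)) (kothe_measurable _)).
- ae_use eE; apply: aeW => t ->; rewrite normrZ normfV normr_id.
  have [->|t0] := eqVneq (kb_rep F t) 0; first by rewrite normr0 mulr0.
  by rewrite mulVf ?normr_eq0.
- ae_use eE; ae_use (kb_absE F); apply: aeW => t -> ->.
  have [->|t0] := eqVneq (kb_rep F t) 0; first by rewrite !scaler0.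
  by rewrite scalerA divff ?normr_eq0// scale1r.
Qed.

Lemma kothe_bochner_sluacs_plus : measure_is_complete mu -> sluacs_plus X ->
  sluacs_plus E -> order_continuous E -> sluacs_plus (kothe_bochner E X).
Proof.
move=> cmu sX sE oE; apply: sluacs_at_plus => f f1 e e0.
pose u := kb_abs f; have u1 : `|u| = 1 by rewrite norm_kb_abs.
have u0 : \forall t \ae mu, 0 <= kothe_rep u t.
  by ae_use (kb_absE f); apply: aeW => t ->.
have su := sluacs_plus_at sE u1.
have [ep ep0 [ep1 epe]] : exists2 ep : R, 0 < ep & ep <= 1 /\ 5 * ep <= e.
  exists (Num.min 1 (e / 5)); first by rewrite lt_min ltr01 divr_gt0.
  split; first by rewrite ge_min lexx.
  by rewrite mulrC -ler_pdivlMr// ge_min lexx orbT.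
have [c5 c50 c5P] := small_set_negligible su ep0.
(* The points of [S m] are those where [1 / (m + 1)] is an admissible
   shortening; order continuity makes the rest negligible for [u]. *)
pose S m := shortening_set (X := X) ep m.+1%:R^-1.
pose D m := ~` (kb_rep f @^-1` S m).
have mD m : measurable (D m).
  apply: measurableC.
  apply: (bochner_closed_preimage cmu (kb_rep_bochner f)).
  exact: closed_shortening_set.
have [m uD] : exists m, `|kothe_restr (D m) u| <= c5.
  apply: oE => // [m n mn|t].
    apply: subsetC => t; apply: shortening_set_anti.
    by rewrite lef_pV2 ?posrE// ler_nat ltnS.
  have [dl dl0 dlP] := shortening_set_cover (kb_rep f t) sX ep0.
  have [n _ nP] := near_infty_natSinv_lt (PosNum dl0).
  exists n; apply; apply: shortening_set_anti dlP.
  exact: ltW (nP n (leqnn n)).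
(* The set [D m] was chosen with a tolerance depending on [ep] only, whereas the
   comparable set is chosen after [tau], with tolerance [tau * ep]. *)
pose tau : R := m.+1%:R^-1.
have tau0 : 0 < tau by rewrite invr_gt0.
have tau1 : tau <= 1 by rewrite invf_le1// ler1n.
have [c c0 cP] := comparable_set_concentration su u1 u0 (mulr_gt0 tau0 ep0).
have [eta [eta0 eta1 etac]] : exists eta : R,
    [/\ 0 < eta, eta <= 1 & eta * (1 + c^-1) < tau].
  have ci0 : 0 < c^-1 by rewrite invr_gt0.
  have k0 : 0 < 1 + c^-1 by rewrite addr_gt0.
  exists (tau / 2 / (1 + c^-1)); split.
  - by rewrite !divr_gt0.
  - by rewrite ler_pdivrMr// mul1r; lra.
  - by rewrite divfK ?gt_eqF//; lra.
have [c4 c40 c4P] := cP eta eta0 eta1.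
exists (Num.min c4 c5); first by rewrite lt_min c40.
have [le4 le5] : Num.min c4 c5 <= c4 /\ Num.min c4 c5 <= c5.
  by split; rewrite ge_min lexx ?orbT.
move: (Num.min c4 c5) le4 le5 => dl le4 le5 g phi g1 phi1 fg.
pose v := kb_abs g; pose w := kb_abs (f + g).
have v1 : `|v| <= 1 by rewrite norm_kb_abs.
have v0 : \forall t \ae mu, 0 <= kothe_rep v t.
  by ae_use (kb_absE g); apply: aeW => t ->.
have wuv : \forall t \ae mu,
    0 <= kothe_rep w t <= kothe_rep u t + kothe_rep v t.
  ae_use (kb_absE f); ae_use (kb_absE g); ae_use (kb_absE (f + g)).
  ae_use (kb_repD f g); apply: aeW => t fgt wt vt ut.
  by rewrite /w wt /v vt /u ut fgt normr_ge0 ler_normD.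
have w2 : 2 - dl < `|w| by rewrite norm_kb_abs.
have uv2 : 2 - dl < `|u + v|.
  apply: lt_le_trans w2 _; apply: kothe_le; ae_use wuv; ae_use (kothe_addE u v).
  by apply: aeW => t -> /andP[h1 h2]; rewrite !ger0_norm// (le_trans h1).
pose G := comparable_set u eta c v w.
have mG : measurable G by exact: measurable_comparable_set.
have mGD : measurable (G `&` D m) by exact: measurableI.
have GD : \forall t \ae mu, G t -> ~ D m t ->
    `| kothe_rep u t *: (`|kb_rep g t|^-1 *: kb_rep g t) - tau *: kb_rep f t|
      <= (1 - tau * (1 - ep)) * kothe_rep u t /\
    `| kothe_rep v t *: (`|kb_rep f t|^-1 *: kb_rep f t) - tau *: kb_rep g t|
      <= (1 - tau * (1 - ep)) * kothe_rep v t.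
  ae_use (kb_absE f); ae_use (kb_absE g); ae_use (kb_absE (f + g)).
  ae_use (kb_repD f g); apply: aeW => t fgt wt vt ut [[]] + + + /contrapT fS.
  rewrite /level_set /= /w wt /v vt /u ut fgt => h1 h2 h3.
  exact: (comparable_shortening c0 eta0 etac (lexx _) h1 h2 h3 fS).
have restrJ (psi : dual E) (J : E -> kothe_bochner E X) (h : T -> X) :
    (forall s, \forall t \ae mu, kb_rep (J s) t = kothe_rep s t *: h t) ->
    (forall s F, (\forall t \ae mu, kb_rep F t = kothe_rep s t *: h t) ->
      phi F = psi s) ->
    forall s A, measurable A -> phi (kb_restr A (J s)) = psi (kothe_restr A s).
  move=> JE phiE s A mA; apply: phiE.
  ae_use (kb_restrE (J s) mA); ae_use (JE s); ae_use (kothe_restrE s mA).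
  by apply: aeW => t -> -> ->; rewrite scalerA.
have subl_le (k a b : R) : a <= b -> k - b <= k - a by rewrite lerD2l lerN2.
split=> phi_ge.
- have [h [mh h1 gh hE]] := kb_direction g.
  have [psi [J [psi1 JE phiE]]] := scalar_functional phi1 mh h1.
  have psiv : 1 - dl <= psi v by rewrite -(phiE v g gh).
  have [psiG _] := c4P v w psi v1 psi1 v0 wuv
    (le_lt_trans (subl_le 2 _ _ le4) w2)
    (or_intror (le_trans (subl_le 1 _ _ le4) psiv)).
  have [psiD _] := c5P v psi (D m) v1 psi1 (mD m) uD
    (le_lt_trans (subl_le 2 _ _ le5) uv2)
    (or_intror (le_trans (subl_le 1 _ _ le5) psiv)) G mG.
  apply: (@le_trans _ _ (1 - 5 * ep)); first exact: subl_le.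
  apply: (@shortened_functional_le _ _ _ _ _ _ phi (J u) f u G (D m) tau) => //.
  + by rewrite u1.
  + exact: ltW.
  + ae_use (JE u); ae_use h1; ae_use u0; apply: aeW => t ut ht ->.
    by rewrite normrZ ger0_norm// ler_piMr.
  + by ae_use (kb_absE f); apply: aeW => t; rewrite /u => ->.
  + ae_use (JE u); ae_use hE; ae_use GD.
    by apply: aeW => t GDt -> -> Gt Dt; have [] := GDt Gt Dt.
  + by rewrite (restrJ psi J h).
  + by rewrite (restrJ psi J h).
- have [h [mh h1 fh hE]] := kb_direction f.
  have [psi [J [psi1 JE phiE]]] := scalar_functional phi1 mh h1.
  have psiu : 1 - dl <= psi u by rewrite -(phiE u f fh).
  have [_ psiG] := c4P v w psi v1 psi1 v0 wuv
    (le_lt_trans (subl_le 2 _ _ le4) w2)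
    (or_introl (le_trans (subl_le 1 _ _ le4) psiu)).
  have [_ psiD] := c5P v psi (D m) v1 psi1 (mD m) uD
    (le_lt_trans (subl_le 2 _ _ le5) uv2)
    (or_introl (le_trans (subl_le 1 _ _ le5) psiu)) G mG.
  apply: (@le_trans _ _ (1 - 5 * ep)); first exact: subl_le.
  apply: (@shortened_functional_le _ _ _ _ _ _ phi (J v) g v G (D m) tau) => //.
  + exact: ltW.
  + ae_use (JE v); ae_use h1; ae_use v0; apply: aeW => t vt ht ->.
    by rewrite normrZ ger0_norm// ler_piMr.
  + by ae_use (kb_absE g); apply: aeW => t; rewrite /v => ->.
  + ae_use (JE v); ae_use hE; ae_use GD.
    by apply: aeW => t GDt -> -> Gt Dt; have [] := GDt Gt Dt.
  + by rewrite (restrJ psi J h).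
  + by rewrite (restrJ psi J h).
Qed.

End transfer.

Theorem theorem3p11 (R : realType) (d : measure_display) (T : measurableType d)
    (mu : {measure set T -> \bar R})
    (mu_complete : measure_is_complete mu)
    (mu_sigma_finite : sigma_finite [set: T]%classic mu)
    (E : kothe_space mu) (X : completeNormedModType R) :
  sluacs_plus X ->
  dual_kadets_klee_star E ->
  [/\ sluacs_plus E, reflexive_space E & kadets_klee E] \/
  (LUR E /\ weak_star_seq_compact (closed_unit_ball (dual E))) ->
  sluacs_plus (kothe_bochner E X).
Proof.
move=> sX _ [[sE rE _]|[lE wE]]; apply: kothe_bochner_sluacs_plus => //.
- exact: reflexive_order_continuous.
- exact: LUR_sluacs_plus.
- exact: weak_star_seq_compact_order_continuous.
Qed.
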